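(* If $\mathcal{P}$ is a toral poset, then the simplicial complex $\Sigma(\mathcal{P})$ is homotopic (i.e. homotopy equivalent) to a wedge sum of $\operatorname{ind}\mathfrak{g}_A(\mathcal{P})$ one-spheres.
   Context: **Posets and Lie poset algebras.** $\mathbf{k}$ is a field of characteristic zero. All posets are finite. For a poset $(\mathcal{P},\preceq)$: $Rel(\mathcal{P})$ is the set of strict relations of $\mathcal{P}$, viewed as ordered pairs $(p,q)$ with $p\preceq q$, $p\ne q$; $Ext(\mathcal{P})$ is the set of all minimal and maximal elements of $\mathcal{P}$. The comparability graph of $\mathcal{P}$ has vertex set $\mathcal{P}$ and an edge for every element of $Rel(\mathcal{P})$. A subset $I\subset\mathcal{P}$ is an (order) ideal if $x\in I$, $y\preceq x$ imply $y\in I$; a subset $U\subset \mathcal{P}$ is a filter if $x\in U$, $x\preceq y$ imply $y\in U$. $\Sigma(\mathcal{P})$ is the simplicial complex whose $n$-dimensional faces are the chains of cardinality $n+1$ in $\mathcal{P}$ (the order complex). $\mathfrak{g}(\mathcal{P})$ is the Lie algebra with $\mathbf{k}$-basis $\{E_{p,q}: p\preceq q\}$, with bracket $[a,b]=ab-ba$ for the associative product $E_{p,q}E_{r,s}=E_{p,s}$ if $q=r$ and $0$ otherwise; $\mathfrak{g}_A(\mathcal{P})$ is the Lie subalgebra of elements $\sum c_{p,q}E_{p,q}$ with trace $\sum_p c_{p,p}=0$. **Index, Frobenius, spectrum.** For a Lie algebra $\mathfrak{g}$ and $F\in\mathfrak{g}^*$, $B_F(x,y)=F([x,y])$, and $\operatorname{ind}\mathfrak{g}=\min_{F\in\mathfrak{g}^*}\dim\ker(B_F)$.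 $\mathfrak{g}$ is Frobenius if $\operatorname{ind}\mathfrak{g}=0$; $F$ is then a Frobenius functional if $\dim\ker(B_F)=0$. The principal element $\widehat{F}\in\mathfrak{g}$ of a Frobenius functional $F$ is the unique element with $B_F(\widehat F,-)=F$. The spectrum of a Frobenius Lie algebra $\mathfrak{g}$ is the multiset of eigenvalues of $ad(\widehat F)=[\widehat F,-]:\mathfrak{g}\to\mathfrak{g}$ (independent of the choice of $F$); it is binary if it consists of an equal number of $0$'s and $1$'s. A poset $\mathcal{P}$ is Frobenius if $\mathfrak{g}_A(\mathcal{P})$ is Frobenius. **Functionals.** $E^*_{p,q}$ is the functional sending $B=\sum b_{p,q}E_{p,q}$ to $b_{p,q}$. All functionals considered have the form $F=F_S=\sum_{(p,q)\in S}E^*_{p,q}$ with $S\subset Rel(\mathcal{P})$; the same formula defines $F$ on $\mathfrak{g}(\mathcal{P})$. $\Gamma_F=\Gamma_F(\mathcal{P})$ is the directed subgraph of the comparability graph with a directed edge from $p$ to $q$ for each $(p,q)\in S$. $F$ is small if $\Gamma_F$ is a spanning subtree of the comparability graph. For small $F$: $U_F(\mathcal{P})$ is the set of sinks of $\Gamma_F$, $D_F(\mathcal{P})$ the set of sources, $B_F(\mathcal{P})$ the set of vertices that are neither. $\mathfrak{g}(\mathcal{P})\cap\ker(F)$ denotes the set of $B\in\mathfrak{g}(\mathcal{P})$ with $F([x,B])=0$ for all $x\in\mathfrak{g}(\mathcal{P})$. **Toral-pairs.** For a Frobenius poset $\mathcal{P}$ and a Frobenius functional $F\in(\mathfrak{g}_A(\mathcal{P}))^*$,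 $(\mathcal{P},F)$ is a toral-pair if: (P1) $|Ext(\mathcal{P})|=2$ or $3$; (P2) $\mathfrak{g}_A(\mathcal{P})$ has a binary spectrum; (P3) $\Sigma(\mathcal{P})$ is contractible; (F1) $F$ is small; (F2) $U_F(\mathcal{P})$ is a filter, $D_F(\mathcal{P})$ is an ideal, and $B_F(\mathcal{P})=\emptyset$; (F3) $\Gamma_F$ contains all edges of the comparability graph between elements of $Ext(\mathcal{P})$; (F4) every $B\in\mathfrak{g}(\mathcal{P})\cap\ker(F)$ satisfies $E^*_{p,p}(B)=E^*_{q,q}(B)$ for all $p,q\in\mathcal{P}$ and $E^*_{p,q}(B)=0$ for all $p\preceq q$, $p\neq q$. **Construction rules.** Let $(\mathcal{S},F)$ be a toral-pair and $\mathcal{Q}$ a poset. One combines $\mathcal{S}$ and $\mathcal{Q}$ by identifying minimal (resp. maximal) elements of $\mathcal{S}$ with minimal (resp. maximal) elements of $\mathcal{Q}$ (the result is the union of the two posets glued along the identified elements, with the union of the two order relations). If $|Ext(\mathcal{S})|=2$ write $Ext(\mathcal{S})=\{a,b\}$ with $a\preceq b$ or $b\preceq a$; if $|Ext(\mathcal{S})|=3$ write $Ext(\mathcal{S})=\{a,b,c\}$ with either $a\preceq b,c$ or $b,c\preceq a$. Let $x,y,z\in Ext(\mathcal{Q})$; if $a$, $b$, $c$ are identified with elements of $\mathcal{Q}$, these are $x$, $y$, $z$ respectively. Write $\sim_{\mathcal{Q}}$ for ''comparable in $\mathcal{Q}$'' and $\nsim_{\mathcal{Q}}$ for ''not comparable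 in $\mathcal{Q}$''. Rules (only the listed elements are identified): if $|Ext(\mathcal{S})|=2$ or $3$: $A_1$: identify $b$ with $y$; $C$: identify $a$ with $x$; $E_1$: identify $a,b$ with $x,y$ where $x\nsim_{\mathcal{Q}}y$. If $|Ext(\mathcal{S})|=3$: $A_2$: identify $c$ with $z$; $B$: identify $b,c$ with $y,z$; $D_1$: identify $a,b$ with $x,y$ where $x\sim_{\mathcal{Q}}y$; $D_2$: identify $a,c$ with $x,z$ where $x\sim_{\mathcal{Q}}z$; $E_2$: identify $a,c$ with $x,z$ where $x\nsim_{\mathcal{Q}}z$; $F$: identify $a,b,c$ with $x,y,z$ where $x\sim_{\mathcal{Q}}y$, $x\sim_{\mathcal{Q}}z$; $G_1$: identify $a,b,c$ with $x,y,z$ where $x\sim_{\mathcal{Q}}y$, $x\nsim_{\mathcal{Q}}z$; $G_2$: identify $a,b,c$ with $x,y,z$ where $x\nsim_{\mathcal{Q}}y$, $x\sim_{\mathcal{Q}}z$; $H$: identify $a,b,c$ with $x,y,z$ where $x\nsim_{\mathcal{Q}}y$, $x\nsim_{\mathcal{Q}}z$. **Toral posets.** A poset $\mathcal{P}$ is toral if there are toral-pairs $\{(\mathcal{S}_i,F_{\mathcal{S}_i})\}_{i=1}^n$ and posets $\mathcal{S}_1=\mathcal{Q}_1\subset\mathcal{Q}_2\subset\cdots\subset\mathcal{Q}_n=\mathcal{P}$ (a construction sequence for $\mathcal{P}$) such that, for $i=2,\dots,n$, $\mathcal{Q}_i$ is formed from $\mathcal{Q}_{i-1}$ and $\mathcal{S}_i$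 by applying a rule from $\{A_1,A_2,B,C,D_1,D_2,E_1,E_2,F,G_1,G_2,H\}$. A wedge sum of zero one-spheres is a point. *)

(* Defs.v *)
From HB Require Import structures.
From mathcomp Require Import all_boot all_order all_algebra.
From mathcomp Require Import all_classical all_reals all_analysis.
From mathcomp Require Import homotopy_theory.homotopy.

Set Implicit Arguments.
Unset Strict Implicit.
Unset Printing Implicit Defensive.

Import Order.TTheory GRing.Theory Num.Theory.
Import numFieldNormedType.Exports.

Local Open Scope ring_scope.

Section Homotopy.
Local Open Scope classical_set_scope.
Variable R : realType.

(* A homotopy is a map on X * R whose behaviour outside X * [0, 1] is
   irrelevant. *)
Definition homotopic (X Y : topologicalType) (f g : X -> Y) : Prop :=
  exists H : X * R -> Y,
    [/\ {within [set: X] `*` `[0, 1], continuous H},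
        forall x, H (x, 0) = f x
      & forall x, H (x, 1) = g x].

Definition homotopy_equivalent (X Y : topologicalType) : Prop :=
  exists f : X -> Y, exists g : Y -> X,
    [/\ continuous f, continuous g,
        homotopic (g \o f) idfun & homotopic (f \o g) idfun].

Definition one_point : topologicalType := discrete_topology unit.

Definition contractible (X : topologicalType) : Prop :=
  homotopy_equivalent X one_point.

Definition circle_set : set (R * R)%type :=
  [set z : R * R | z.1 ^+ 2 + z.2 ^+ 2 = 1].

Definition circle : topologicalType := set_type circle_set.

Lemma circle_base_subproof : ((1, 0) : R * R) \in circle_set.
Proof. by rewrite inE /circle_set /= expr1n expr0n addr0. Qed.

Definition circle_base : circle := SigSub circle_base_subproof.

(* The library's [wedge] of an empty family is empty, hence the case n = 0. *)
Definition wedge_of_circles (n : nat) : topologicalType :=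
  match n with
  | 0 => one_point
  | m.+1 => wedge (fun _ : 'I_m.+1 => circle_base)
  end.

(* Geometric realization, in barycentric coordinates, of the abstract simplicial
   complex on the finite vertex set V whose faces are the members of K. *)
Definition realization_set (V : finType) (K : {set {set V}}) :
    set (prod_topology (fun _ : V => R : topologicalType)) :=
  [set x : V -> R | [/\ forall v, 0 <= x v, \sum_v x v = 1
                     & [set v | x v != 0]%SET \in K]].

Definition realization (V : finType) (K : {set {set V}}) : topologicalType :=
  set_type (realization_set K).

End Homotopy.

Section LieSubalgebra.
Variables (k : fieldType) (n : nat).
Implicit Types (L : {vspace 'M[k]_n}) (F : 'Hom('M[k]_n, k^o)) (x y : 'M[k]_n).

Definition lie_bracket x y : 'M[k]_n := x *m y - y *m x.

(* B_F(-, y) *)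
Definition lie_form F y x : k^o := F (lie_bracket x y).

Fact lie_form_linear F y : linear (lie_form F y).
Proof.
move=> a u v; rewrite /lie_form -linearP; congr (F _).
rewrite /lie_bracket mulmxDl mulmxDr -scalemxAl -scalemxAr scalerBr.
by rewrite opprD addrACA.
Qed.

HB.instance Definition _ F y :=
  GRing.isLinear.Build k 'M[k]_n k^o _ (lie_form F y) (lie_form_linear F y).

(* Below, a functional on L is given by an extension F of it to all matrices;
   only the restriction of F to L matters, and every element of the dual of L
   arises in this way. *)

(* The kernel of B_F on L, see [mem_ker_form]. *)
Definition ker_form L F : {vspace 'M[k]_n} :=
  (L :&: \bigcap_(i < \dim L) lker (linfun (lie_form F (vbasis L)`_i)))%VS.

Lemma mem_ker_form L F x :
  x \in ker_form L F <->
  x \in L /\ forall y, y \in L -> F (lie_bracket x y) = 0.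
Proof.
have formC u v : F (lie_bracket u v) = - lie_form F u v.
  by rewrite /lie_form -linearN /lie_bracket opprB.
rewrite memv_cap; split=> [/andP[xL xK]|[xL xK]].
  split=> // y /coord_vbasis ->.
  rewrite formC linear_sum big1 ?oppr0 // => i _.
  rewrite linearZ /= /lie_form formC.
  move: xK; rewrite memvE => /subv_bigcapP/(_ i isT).
  rewrite -memvE memv_ker lfunE /= => /eqP ->.
  by rewrite oppr0 scaler0.
rewrite xL memvE; apply/subv_bigcapP => i _; rewrite -memvE memv_ker lfunE /=.
by rewrite /lie_form xK // vbasis_mem // mem_nth // size_tuple.
Qed.

Fact lie_index_subproof L :
  exists m, `[< exists F, \dim (ker_form L F) = m >].
Proof. by exists (\dim (ker_form L 0)); apply/asboolP; exists 0. Qed.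

Definition lie_index L : nat := ex_minn (lie_index_subproof L).

Definition frobenius L : Prop := lie_index L = 0%N.

Definition frobenius_functional L F : Prop := \dim (ker_form L F) = 0%N.

Definition principal_element L F x : Prop :=
  x \in L /\ forall y, y \in L -> F (lie_bracket x y) = F y.

(* Row i holds the coordinates of ad x (e_i) in the basis [vbasis L] = (e_i) of
   L. *)
Definition ad_mx L x : 'M[k]_(\dim L) :=
  \matrix_(i, j) coord (vbasis L) j (lie_bracket x (vbasis L)`_i).

(* s is the multiset of eigenvalues, with algebraic multiplicity, of ad x for x
   the principal element of any Frobenius functional. *)
Definition has_spectrum L (s : seq k) : Prop :=
  frobenius L /\
  forall F x, frobenius_functional L F -> principal_element L F x ->
    char_poly (ad_mx L x) = \prod_(a <- s) ('X - a%:P).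

Definition binary_spectrum L : Prop :=
  exists m, has_spectrum L (nseq m 0 ++ nseq m 1).

End LieSubalgebra.

Section Poset.
Context {d : Order.disp_t} (P : finPOrderType d).
Implicit Types p q : P.

Definition minimal p : bool := [forall q, (q <= p)%O ==> (q == p)].
Definition maximal p : bool := [forall q, (p <= q)%O ==> (q == p)].
Definition Ext : {set P} := [set p | minimal p || maximal p].
Definition Rel : {set P * P} := [set pq : P * P | (pq.1 < pq.2)%O].

Definition order_ideal (A : {set P}) : Prop :=
  forall x y, x \in A -> (y <= x)%O -> y \in A.
Definition order_filter (A : {set P}) : Prop :=
  forall x y, x \in A -> (x <= y)%O -> y \in A.

Definition order_complex : {set {set P}} :=
  [set c : {set P} | (c != finset.set0) && [forall p in c, forall q in c, (p >=< q)%O]].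

End Poset.

Section LiePosetAlgebra.
Context (k : fieldType) {d : Order.disp_t} (P : finPOrderType d).

Definition poset_E (p q : P) : 'M[k]_#|P| :=
  delta_mx (enum_rank p) (enum_rank q).

(* E*_{p,q}(A) *)
Definition poset_coeff (A : 'M[k]_#|P|) (p q : P) : k :=
  A (enum_rank p) (enum_rank q).

Definition lie_poset : {vspace 'M[k]_#|P|} :=
  <<[seq poset_E pq.1 pq.2 | pq <- enum [pred pq : P * P | (pq.1 <= pq.2)%O]]>>%VS.

Definition mxtr (A : 'M[k]_#|P|) : k^o := \tr A.

Fact mxtr_linear : linear mxtr.
Proof. by move=> a A B; rewrite /mxtr mxtraceD mxtraceZ. Qed.

HB.instance Definition _ :=
  GRing.isLinear.Build k 'M[k]_#|P| k^o _ mxtr mxtr_linear.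

Definition lie_posetA : {vspace 'M[k]_#|P|} :=
  (lie_poset :&: lker (linfun mxtr))%VS.

Definition sum_coeff (S : {set P * P}) (A : 'M[k]_#|P|) : k^o :=
  \sum_(pq in S) poset_coeff A pq.1 pq.2.

Fact sum_coeff_linear S : linear (sum_coeff S).
Proof.
move=> a A B; rewrite /sum_coeff /poset_coeff scaler_sumr -big_split /=.
by apply: eq_bigr => pq _; rewrite !mxE.
Qed.

HB.instance Definition _ S :=
  GRing.isLinear.Build k 'M[k]_#|P| k^o _ (sum_coeff S) (sum_coeff_linear S).

(* F_S *)
Definition poset_functional (S : {set P * P}) : 'Hom('M[k]_#|P|, k^o) :=
  linfun (sum_coeff S).

End LiePosetAlgebra.

Section ToralPair.
Context {d : Order.disp_t} (P : finPOrderType d).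
Implicit Types S : {set P * P}.

(* Gamma_F has vertex set P and edge set S. *)
Definition sinks S : {set P} := [set p | [forall q, (p, q) \notin S]].
Definition sources S : {set P} := [set p | [forall q, (q, p) \notin S]].
Definition inner_vertices S : {set P} := ~: (sinks S :|: sources S).

Definition is_tree (T : finType) (e : rel T) : Prop :=
  (forall x y, connect e x y) /\
  (forall c : seq T, ucycle e c -> (size c <= 2)%N).

Definition small S : Prop :=
  S \subset Rel P /\
  is_tree (fun p q : P => ((p, q) \in S) || ((q, p) \in S)).

Record toral_pair (k : fieldType) (R : realType) S : Prop := ToralPair {
  toral_frobenius : frobenius (lie_posetA k P);
  toral_functional :
    frobenius_functional (lie_posetA k P) (poset_functional k S);
  toral_P1 : #|Ext P| = 2%N \/ #|Ext P| = 3%N;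
  toral_P2 : binary_spectrum (lie_posetA k P);
  toral_P3 : contractible R (realization R (order_complex P));
  toral_F1 : small S;
  toral_F2 : [/\ order_filter (sinks S), order_ideal (sources S)
               & inner_vertices S = finset.set0];
  toral_F3 : forall p q : P, p \in Ext P -> q \in Ext P -> (p < q)%O ->
    (p, q) \in S;
  toral_F4 : forall B : 'M[k]_#|P|, B \in lie_poset k P ->
    (forall x, x \in lie_poset k P ->
      poset_functional k S (lie_bracket x B) = 0) ->
    (forall p q : P, poset_coeff B p p = poset_coeff B q q) /\
    (forall p q : P, (p < q)%O -> poset_coeff B p q = 0)
}.

End ToralPair.

Section Rules.
Context {dS dQ : Order.disp_t} (S : finPOrderType dS) (Q : finPOrderType dQ).

Definition labelled2 (a b : S) : Prop :=
  [/\ #|Ext S| = 2%N, Ext S = [set a; b] & (a <= b)%O \/ (b <= a)%O].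

Definition labelled3 (a b c : S) : Prop :=
  [/\ #|Ext S| = 3%N, Ext S = [set a; b; c]
    & (a <= b)%O /\ (a <= c)%O \/ (b <= a)%O /\ (c <= a)%O].

Definition labelled23 (a b : S) : Prop :=
  labelled2 a b \/ exists c, labelled3 a b c.

Definition matching (s : S) (q : Q) : bool :=
  (minimal s && minimal q) || (maximal s && maximal q).

(* [construction_rule I]: one of the rules allows exactly the identifications
   listed in I. *)
Inductive construction_rule : {set S * Q} -> Prop :=
| rule_A1 a b y : labelled23 a b -> matching b y ->
    construction_rule [set (b, y)]
| rule_A2 a b c z : labelled3 a b c -> matching c z ->
    construction_rule [set (c, z)]
| rule_B a b c y z : labelled3 a b c -> matching b y -> matching c z ->
    construction_rule [set (b, y); (c, z)]
| rule_C a b x : labelled23 a b -> matching a x ->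
    construction_rule [set (a, x)]
| rule_D1 a b c x y : labelled3 a b c -> matching a x -> matching b y ->
    (x >=< y)%O ->
    construction_rule [set (a, x); (b, y)]
| rule_D2 a b c x z : labelled3 a b c -> matching a x -> matching c z ->
    (x >=< z)%O ->
    construction_rule [set (a, x); (c, z)]
| rule_E1 a b x y : labelled23 a b -> matching a x -> matching b y ->
    (x >< y)%O ->
    construction_rule [set (a, x); (b, y)]
| rule_E2 a b c x z : labelled3 a b c -> matching a x -> matching c z ->
    (x >< z)%O ->
    construction_rule [set (a, x); (c, z)]
| rule_F a b c x y z : labelled3 a b c ->
    matching a x -> matching b y -> matching c z ->
    (x >=< y)%O -> (x >=< z)%O ->
    construction_rule [set (a, x); (b, y); (c, z)]
| rule_G1 a b c x y z : labelled3 a b c ->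
    matching a x -> matching b y -> matching c z ->
    (x >=< y)%O -> (x >< z)%O ->
    construction_rule [set (a, x); (b, y); (c, z)]
| rule_G2 a b c x y z : labelled3 a b c ->
    matching a x -> matching b y -> matching c z ->
    (x >< y)%O -> (x >=< z)%O ->
    construction_rule [set (a, x); (b, y); (c, z)]
| rule_H a b c x y z : labelled3 a b c ->
    matching a x -> matching b y -> matching c z ->
    (x >< y)%O -> (x >< z)%O ->
    construction_rule [set (a, x); (b, y); (c, z)].

(* P is, via f and g, the union of S and Q glued along I, with the union of the
   two orders. As f and g are injective, I cannot identify two elements of the
   same poset. *)
Definition glued (I : {set S * Q}) {dP : Order.disp_t} (P : finPOrderType dP) :
    Prop :=
  exists f : S -> P, exists g : Q -> P,
    [/\ injective f, injective g,
        forall p, (exists s, f s = p) \/ (exists q, g q = p),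
        forall s q, f s = g q <-> (s, q) \in I
      & forall p p' : P, (p <= p')%O <->
          (exists s s', [/\ f s = p, f s' = p' & (s <= s')%O]) \/
          (exists q q', [/\ g q = p, g q' = p' & (q <= q')%O])].

End Rules.

(* A derivation is a construction sequence: the base case is Q_1 = S_1, and each
   use of [toral_step] passes from Q_{i-1} = Q and S_i = S to Q_i = P. *)
Inductive toral_poset (k : fieldType) (R : realType) :
    forall d : Order.disp_t, finPOrderType d -> Prop :=
| toral_base d (P : finPOrderType d) (F : {set P * P}) :
    toral_pair k R F -> toral_poset k R P
| toral_step dQ (Q : finPOrderType dQ) dS (S : finPOrderType dS)
    (F : {set S * S}) (I : {set S * Q}) dP (P : finPOrderType dP) :
    toral_poset k R Q -> toral_pair k R F ->
    construction_rule I -> glued I P -> toral_poset k R P.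

(* Main.v *)
(* Let N be the set of relations running from a source to a sink of one of the
   graphs of the functionals of the pieces, and Z its complement in the set of
   strict relations. The span of N is an abelian subalgebra of g_A(P) and a
   complement of the subalgebra g_0 of trace zero matrices supported on Z and the
   diagonal. The first is isotropic for every functional, so every form B_F has a
   kernel of dimension at least 2|N| - dim g_A(P). For the union F of the given
   small functionals, g_0 is isotropic as well and (F4) shows that it meets the
   kernel trivially, which gives equality. As |N| - |Z| - |P| + 1 vanishes for a
   Frobenius piece and shared relations join extremal elements, counting gives
   ind g_A(P) = |Rel_E| - |Ext(P)| + 1, where Rel_E is the set of relations
   between extremal elements.

   On the topological side, a toral-pair has a least or a greatest element.
   Hence each non-extremal element of P lies above a unique minimal element or
   below a unique maximal one; moving it there deforms the order complex of P
   onto the connected graph (Ext(P), Rel_E). Outside a spanning tree L this graph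
   has |Rel_E| - |Ext(P)| + 1 edges. Collapsing L and wrapping the remaining
   edges around the circles is inverted up to homotopy by the loops which
   traverse these edges and return along the contraction of L. *)

Require Import Defs.
From HB Require Import structures.
From mathcomp Require Import all_boot all_order all_algebra.
From mathcomp Require Import all_classical all_reals all_analysis.
From mathcomp Require Import homotopy_theory.homotopy.
From mathcomp Require Import lra zify.

Set Implicit Arguments.
Unset Strict Implicit.
Unset Printing Implicit Defensive.

Import Order.TTheory GRing.Theory Num.Theory.
Import numFieldNormedType.Exports.

Local Open Scope ring_scope.
Local Open Scope classical_set_scope.

(** * Homotopies *)

(** The twelve rules are treated alike, as gluings along a nonempty set of pairs that match minimal
    elements with minimal ones and maximal elements with maximal ones. The obstacle is that
    relations between identified elements may or may not merge, so the change of the index depends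
    on the rule. The remedy is to carry only statements that split over the two sides. Since dim
    g_A(P) = |P| + |N| + |Z| - 1, the bound 2|N| - dim g_A(P) is |N| - |Z| - |P| + 1. It equals
    |Rel_E| - |Ext(P)| + 1 exactly when |N \ Rel_E| = |Z| + |P \ Ext(P)|, and both sides of this
    equation are additive, because everything shared is extremal. For a piece, Rel_E is a star,
    hence a tree, and the equation becomes the Frobenius count. (F4) splits as well: a glued element
    of S with something of S strictly below it is maximal on both sides, so nothing of Q lies above
    it, and the kernel equation at a pair of N involves entries of a single piece. *)

Lemma closed_cover_continuous (X Y : topologicalType) (I : finType)
    (A : I -> set X) (f : X -> Y) :
    (forall i, closed (A i)) -> (forall x, exists i, A i x) ->
    (forall i, {within A i, continuous f}) ->
  continuous f.
Proof.
move=> cA covA cf; apply/continuous_closedP => C cC.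
have -> : f @^-1` C = \bigcup_(i in [set: I]) (f @^-1` C `&` A i).
  rewrite eqEsubset; split=> [x Cfx|x [i _ []] //].
  by have [i Aix] := covA x; exists i.
apply: closed_bigcup; first exact: finite_finset.
move=> i _; have /continuous_closedP/(_ _ cC)/closed_subspaceP[V cV] := cf i.
by rewrite -[X in _ = X -> _]/(f @^-1` C `&` A i) => <-; exact: closedI.
Qed.

Lemma eq_within_continuous (X Y : topologicalType) (A : set X) (f g : X -> Y) :
  (forall x, A x -> f x = g x) -> continuous g -> {within A, continuous f}.
Proof.
move=> fg cg; apply: (@subspace_eq_continuous _ _ _ g).
  by move=> x; rewrite inE => /fg fgx; exact: esym fgx.
exact: continuous_subspaceT.
Qed.

Lemma set_type_continuous (X Y : topologicalType) (A : set Y)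
    (f : X -> set_type A) :
  continuous (fun x => set_val (f x)) -> continuous f.
Proof. exact: continuous_comp_initial. Qed.

Lemma set_val_continuous (Y : topologicalType) (A : set Y) :
  continuous (@set_val _ A).
Proof. exact: initial_continuous. Qed.

Lemma prod_topology_continuous (X : topologicalType) (I : eqType)
    (T : I -> topologicalType) (f : X -> prod_topology T) :
  (forall i, continuous (fun x => f x i)) -> continuous f.
Proof.
move=> cf x; apply/cvg_sup => i U [V [[W oW <-] Wfx] /filterS]; apply.
by apply: cf; exact: open_nbhs_nbhs.
Qed.

Lemma pair_continuous (X Y Z : topologicalType) (f : X -> Y) (g : X -> Z) :
  continuous f -> continuous g -> continuous (fun x => (f x, g x)).
Proof. by move=> cf cg x; apply: cvg_pair; [exact: cf|exact: cg]. Qed.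

Lemma comp_continuous (X Y Z : topologicalType) (f : X -> Y) (g : Y -> Z) :
  continuous f -> continuous g -> continuous (fun x => g (f x)).
Proof. by move=> cf cg x; apply: continuous_comp; [exact: cf|exact: cg]. Qed.

Lemma fst_continuous (X Y : topologicalType) : continuous (@fst X Y).
Proof. by move=> x; exact: cvg_fst. Qed.

Lemma snd_continuous (X Y : topologicalType) : continuous (@snd X Y).
Proof. by move=> x; exact: cvg_snd. Qed.

Lemma const_continuous (X Y : topologicalType) (y : Y) :
  continuous (fun _ : X => y).
Proof. by move=> x; exact: cvg_cst. Qed.

Section Homotopies.
Variable R : realType.
Implicit Types X Y Z : topologicalType.

(** Retraction of the line onto [0, 1]. Composing with it makes paths and homotopies continuous on
    the whole line, so subspace topologies on the time axis can be avoided. *)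
Definition clamp (t : R) : R := Num.max 0 (Num.min 1 t).

Lemma clamp_itv t : 0 <= clamp t <= 1.
Proof. by rewrite /clamp le_max lexx ge_max ler01 ge_min lexx. Qed.

Lemma clamp_le0 t : t <= 0 -> clamp t = 0.
Proof. by move=> t0; rewrite /clamp max_l // ge_min t0 orbT. Qed.

Lemma clamp_ge1 t : 1 <= t -> clamp t = 1.
Proof. by move=> t1; rewrite /clamp min_l // max_r. Qed.

Lemma clamp_id t : 0 <= t <= 1 -> clamp t = t.
Proof. by move=> /andP[t0 t1]; rewrite /clamp min_r // max_r. Qed.

Lemma addf_continuous X (f g : X -> R) :
  continuous f -> continuous g -> continuous (fun x => f x + g x).
Proof. by move=> cf cg x; apply: cvgD; [exact: cf|exact: cg]. Qed.

Lemma subf_continuous X (f g : X -> R) :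
  continuous f -> continuous g -> continuous (fun x => f x - g x).
Proof. by move=> cf cg x; apply: cvgB; [exact: cf|exact: cg]. Qed.

Lemma mulf_continuous X (f g : X -> R) :
  continuous f -> continuous g -> continuous (fun x => f x * g x).
Proof. by move=> cf cg x; apply: cvgM; [exact: cf|exact: cg]. Qed.

Lemma closed_lef X (f g : X -> R) :
  continuous f -> continuous g -> closed [set x | f x <= g x].
Proof.
move=> cf cg; rewrite (_ : mkset _ = (fun x => f x - g x) @^-1` [set y | y <= 0]).
  by apply: closed_comp; [move=> x _; exact: subf_continuous|exact: closed_le].
by apply/seteqP; split=> x /=; rewrite subr_le0.
Qed.

Lemma closed_eqf X (f g : X -> R) :
  continuous f -> continuous g -> closed [set x | f x = g x].
Proof.
move=> cf cg; rewrite (_ : mkset _ = (fun x => f x - g x) @^-1` [set y | y = 0]).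
  by apply: closed_comp; [move=> x _; exact: subf_continuous|exact: closed_eq].
by apply/seteqP; split=> x /= => [->|/subr0_eq //]; rewrite subrr.
Qed.

Lemma clamp_continuous : continuous clamp.
Proof.
apply: (@max_fun_continuous _ _ R); first exact: const_continuous.
apply: (@min_fun_continuous _ _ R); first exact: const_continuous.
by move=> x; exact: cvg_id.
Qed.

Lemma clampf_continuous X (f : X -> R) :
  continuous f -> continuous (fun x => clamp (f x)).
Proof. by move=> cf; exact: comp_continuous cf clamp_continuous. Qed.

(** Clamping the time extends a homotopy from [[0, 1]] to the whole line; the clamped map factors
    through the subspace on which [H] is known to be continuous. *)
Lemma homotopicP X Y (f g : X -> Y) :
  homotopic R f g <-> exists H : X * R -> Y,
    [/\ continuous H, forall x, H (x, 0) = f x & forall x, H (x, 1) = g x].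
Proof.
split=> [[H [cH H0 H1]]|[H [cH H0 H1]]]; last first.
  by exists H; split=> //; exact: continuous_subspaceT.
exists (fun z => H (z.1, clamp z.2)); split=> [|x|x]; last 2 first.
- by rewrite /= clamp_le0.
- by rewrite /= clamp_ge1.
pose A : set (X * R) := [set: X] `*` `[0, 1].
have AP (z : X * R) : (z.1, clamp z.2) \in A.
  by rewrite inE; split=> //=; rewrite in_itv /= clamp_itv.
pose h (z : X * R) : set_type A := SigSub (AP z).
have ch : continuous h.
  apply: set_type_continuous; apply: pair_continuous.
    exact: fst_continuous.
  apply: clampf_continuous; exact: snd_continuous.
by move/subspace_sigL_continuousP: cH; exact: comp_continuous ch.
Qed.

Lemma homotopic_refl X Y (f : X -> Y) : continuous f -> homotopic R f f.
Proof.
move=> cf; apply/homotopicP; exists (fun z => f z.1); split=> //.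
exact: comp_continuous (@fst_continuous _ _) cf.
Qed.

Lemma homotopic_sym X Y (f g : X -> Y) : homotopic R f g -> homotopic R g f.
Proof.
move=> /homotopicP[H [cH H0 H1]]; apply/homotopicP.
exists (fun z => H (z.1, 1 - z.2)); split=> [|x|x] /=.
- apply: comp_continuous cH; apply: pair_continuous.
    exact: fst_continuous.
  by apply: subf_continuous; [exact: const_continuous|exact: snd_continuous].
- by rewrite subr0.
- by rewrite subrr.
Qed.

Lemma homotopic_trans X Y (f g h : X -> Y) :
  homotopic R f g -> homotopic R g h -> homotopic R f h.
Proof.
move=> /homotopicP[F [cF F0 F1]] /homotopicP[G [cG G0 G1]]; apply/homotopicP.
pose H (z : X * R) :=
  if z.2 <= 1 / 2 then F (z.1, 2 * z.2) else G (z.1, 2 * z.2 - 1).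
exists H; split=> [|x|x]; last 2 first.
- by rewrite /H ifT /= ?mulr0 ?F0 //; lra.
- by rewrite /H ifF /=; [rewrite -G1; do 2 f_equal; lra | apply/negbTE; lra].
have c2 : continuous (fun z : X * R => 2 * z.2).
  by apply: mulf_continuous; [exact: const_continuous|exact: snd_continuous].
have cfst : continuous (fun z : X * R => z.1) by exact: fst_continuous.
have cFp : continuous (fun z : X * R => F (z.1, 2 * z.2)).
  by apply: comp_continuous cF; exact: pair_continuous.
have cGp : continuous (fun z : X * R => G (z.1, 2 * z.2 - 1)).
  apply: comp_continuous cG; apply: pair_continuous => //.
  by apply: subf_continuous => //; exact: const_continuous.
pose A (b : bool) : set (X * R) :=
  if b then [set z | z.2 <= 1 / 2] else [set z | 1 / 2 <= z.2].
apply: (@closed_cover_continuous _ _ _ A).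
- by case; apply: closed_lef; (exact: snd_continuous || exact: const_continuous).
- by move=> z; case: (lerP z.2 (1/2)) => zle; [exists true|exists false; apply: ltW].
- case.
    by apply: eq_within_continuous cFp => z /= zle; rewrite /H zle.
  (* The two closed halves meet at time 1/2, where both formulas give [g]. *)
  apply: eq_within_continuous cGp => z /= zge; rewrite /H.
  case: ifPn => // zle.
  have -> : z.2 = 1 / 2 by apply/eqP; rewrite eq_le zle zge.
  rewrite (_ : 2 * (1 / 2) = 1); last by lra.
  by rewrite F1 subrr G0.
Qed.

End Homotopies.

(** * Realizations of simplicial complexes *)

Section HomotopyEquivalence.
Variable R : realType.
Implicit Types X Y Z W : topologicalType.

Lemma homotopic_compl X Y Z (h : Y -> Z) (f g : X -> Y) :
  continuous h -> homotopic R f g -> homotopic R (h \o f) (h \o g).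
Proof.
move=> ch /homotopicP[H [cH H0 H1]]; apply/homotopicP.
exists (h \o H); split=> [|x|x] /=; first exact: comp_continuous cH ch.
  by rewrite H0.
by rewrite H1.
Qed.

Lemma homotopic_compr W X Y (h : W -> X) (f g : X -> Y) :
  continuous h -> homotopic R f g -> homotopic R (f \o h) (g \o h).
Proof.
move=> ch /homotopicP[H [cH H0 H1]]; apply/homotopicP.
exists (fun z => H (h z.1, z.2)); split=> [|x|x] /=; last 2 first.
- by rewrite H0.
- by rewrite H1.
apply: comp_continuous cH; apply: pair_continuous; last exact: snd_continuous.
exact: comp_continuous (@fst_continuous _ _) ch.
Qed.

Lemma homotopy_equivalent_trans X Y Z :
  homotopy_equivalent R X Y -> homotopy_equivalent R Y Z ->
  homotopy_equivalent R X Z.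
Proof.
move=> [f [g [cf cg gf fg]]] [f' [g' [cf' cg' gf' fg']]].
exists (f' \o f), (g \o g'); split.
- exact: comp_continuous cf cf'.
- exact: comp_continuous cg' cg.
- apply: homotopic_trans gf.
  exact: (homotopic_compl cg (homotopic_compr cf gf')).
- apply: homotopic_trans fg'.
  exact: (homotopic_compl cf' (homotopic_compr cg' fg)).
Qed.

(** A map that factors through [unit] is constant, with value [g tt]; the given homotopy to the
    identity is run backwards. *)
Lemma contractible_contraction X : contractible R X ->
  exists x0 : X, exists H : X * R -> X,
    [/\ continuous H, forall x, H (x, 0) = x & forall x, H (x, 1) = x0].
Proof.
move=> [f [g [_ _ /homotopic_sym/homotopicP[H [cH H0 H1]] _]]].
exists (g tt), H; split=> // x.
by rewrite H1 /=; case: (f x).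
Qed.

End HomotopyEquivalence.

(** * Barycentric coordinates and simplicial retractions *)

Section Realization.
Variables (R : realType) (V : finType).
Implicit Types (K L : {set {set V}}) (c : {set V}) (x y : V -> R) (r : V -> V).

Definition bary K (x : realization R K) : V -> R := set_val x.

Definition supp x : {set V} := [set v | x v != 0]%SET.

Lemma bary_continuous K (v : V) : continuous (fun x : realization R K => bary x v).
Proof.
pose T := prod_topology (fun _ : V => R : topologicalType).
exact: (@comp_continuous _ T R _ (fun x => x v) (@set_val_continuous T _)
          (@proj_continuous _ (fun _ : V => R : topologicalType) v)).
Qed.

Lemma realization_continuous K (X : topologicalType) (f : X -> realization R K) :
  (forall v, continuous (fun z => bary (f z) v)) -> continuous f.
Proof. by move=> cf; apply: set_type_continuous; exact: prod_topology_continuous. Qed.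

Lemma baryP K (x : realization R K) : realization_set K (bary x).
Proof. exact: set_valP. Qed.

Lemma bary_ge0 K (x : realization R K) v : 0 <= bary x v.
Proof. by have [] := baryP x. Qed.

Lemma bary_sum K (x : realization R K) : \sum_v bary x v = 1.
Proof. by have [] := baryP x. Qed.

Lemma supp_bary K (x : realization R K) : supp (bary x) \in K.
Proof. by have [] := baryP x. Qed.

Lemma bary_inj K : injective (@bary K).
Proof. exact: val_inj. Qed.

Definition of_bary (K : {set {set V}}) (x : V -> R)
    (xK : realization_set K x) : realization R K :=
  SigSub (mem_set xK).

Lemma of_baryK K x (xK : realization_set K x) : bary (of_bary xK) = x.
Proof. by []. Qed.

Definition face_closed K c :=
  forall c' : {set V}, c' \subset c -> c' != finset.set0 -> c' \in K.

Definition simplicial K := forall c, c \in K -> face_closed K c.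

Lemma realization_setP K c x : face_closed K c -> (forall v, 0 <= x v) ->
  \sum_v x v = 1 -> supp x \subset c -> realization_set K x.
Proof.
move=> Kc x0 x1 xc; split=> //; apply: Kc => //.
apply/set0Pn; apply: contrapT => /forallNP xN0.
have : \sum_v x v = 0.
  by rewrite big1 // => v _; have := xN0 v; rewrite inE; case: eqP.
by rewrite x1 => /eqP; rewrite oner_eq0.
Qed.

(** The affine extension of the vertex map [r]: every vertex passes its weight on to its image. *)
Definition push r x (w : V) : R := \sum_(v | r v == w) x v.

Lemma push_ge0 r x w : (forall v, 0 <= x v) -> 0 <= push r x w.
Proof. by move=> x0; exact: sumr_ge0. Qed.

Lemma push_sum r x : \sum_w push r x w = \sum_v x v.
Proof. by rewrite [RHS](partition_big r xpredT). Qed.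

(** Nonnegative weights that are added up cannot cancel. *)
Lemma supp_push r x : (forall v, 0 <= x v) -> supp (push r x) = r @: supp x.
Proof.
move=> x0; apply/setP => w; rewrite inE; apply/idP/imsetP => [xw|[v]].
  apply: contrapT => wN; case/eqP: xw; apply: big1 => v /eqP rv.
  by apply/eqP/negPn/negP => xv; apply: wN; exists v => //; rewrite inE.
rewrite inE => xv ->; rewrite psumr_neq0 //.
by apply/hasP; exists v; rewrite ?mem_index_enum //= eqxx lt_def xv x0.
Qed.

Lemma push_id r x : {in supp x, forall v, r v = v} -> push r x = x.
Proof.
move=> rx; apply/funext => w; rewrite /push.
have xN0 v : v \notin supp x -> x v = 0 by rewrite inE negbK => /eqP.
have [wx|wx] := boolP (w \in supp x).
  rewrite (bigD1 w) ?rx //= big1 ?addr0 // => v /andP[/eqP rv vw].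
  by apply: xN0; apply: contra vw => /rx <-; rewrite rv.
rewrite xN0 // big1 // => v /eqP rv; apply: xN0.
by apply: contra wx => vx; rewrite -rv rx.
Qed.

Lemma push_continuous (X : topologicalType) r (f : X -> V -> R) w :
  (forall v, continuous (fun z => f z v)) -> continuous (fun z => push r (f z) w).
Proof.
move=> cf; apply: continuous_big; last by move=> v _; exact: cf.
by apply: addf_continuous; [exact: fst_continuous|exact: snd_continuous].
Qed.

Lemma supp_segment t x y :
  supp (fun v => (1 - t) * x v + t * y v) \subset supp x :|: supp y.
Proof.
apply/fintype.subsetP => v; rewrite !inE; apply: contraR; rewrite negb_or !negbK.
by move=> /andP[/eqP-> /eqP->]; rewrite !mulr0 addr0.
Qed.

(** The last hypothesis says that [r] is contiguous to the identity: the segment from a point to its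
    image under [push r] stays in the face spanned by [c :|: r @: c], so the straight-line homotopy
    is available. *)
Lemma vertex_retraction K L r : L \subset K ->
    {in L, forall c, {in c, forall v, r v = v}} ->
    {in K, forall c, r @: c \in L} ->
    {in K, forall c, face_closed K (c :|: r @: c)} ->
  homotopy_equivalent R (realization R K) (realization R L).
Proof.
move=> LK rL rK Kr.
have pushP (x : realization R K) : realization_set L (push r (bary x)).
  split=> [w||]; first by apply: push_ge0; exact: bary_ge0.
    by rewrite push_sum bary_sum.
  by rewrite -/(supp _) supp_push ?rK ?supp_bary //; exact: bary_ge0.
have inclP (x : realization R L) : realization_set K (bary x).
  by have [x0 x1 /(fintype.subsetP LK) xK] := baryP x; split.
exists (fun x : realization R K => of_bary (pushP x)).
exists (fun x : realization R L => of_bary (inclP x)); split.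
- apply: realization_continuous => v; apply: push_continuous => w.
  exact: bary_continuous.
- by apply: realization_continuous => v; exact: bary_continuous.
- apply/homotopic_sym/homotopicP.
  have segP (z : realization R K * R) : realization_set K
      (fun v => (1 - clamp z.2) * bary z.1 v + clamp z.2 * push r (bary z.1) v).
    have x0 := bary_ge0 z.1; have /andP[t0 t1] := clamp_itv z.2.
    apply: (realization_setP (Kr _ (supp_bary z.1))) => [v||].
    + by rewrite addr_ge0 // mulr_ge0 ?subr_ge0 ?push_ge0.
    + by rewrite big_split /= -!mulr_sumr push_sum bary_sum; lra.
    + by rewrite -supp_push //; exact: supp_segment.
  exists (fun z => of_bary (segP z)); split=> [|x|x].
  + apply: realization_continuous => v.
    have cz2 : continuous (fun z : realization R K * R => clamp z.2).
      by apply: clampf_continuous; exact: snd_continuous.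
    have cz1 w : continuous (fun z : realization R K * R => bary z.1 w).
      exact: comp_continuous (@fst_continuous _ _) (@bary_continuous _ _).
    apply: addf_continuous; apply: mulf_continuous => //.
      by apply: subf_continuous => //; exact: const_continuous.
    exact: push_continuous.
  + apply: bary_inj; rewrite of_baryK; apply/funext => v /=.
    by rewrite clamp_le0 // subr0 mul1r mul0r addr0.
  + apply: bary_inj; rewrite of_baryK; apply/funext => v /=.
    by rewrite clamp_ge1 // subrr mul0r mul1r add0r.
- rewrite (_ : _ \o _ = idfun); first by apply: homotopic_refl => x; exact: cvg_id.
  apply/funext => x; apply: bary_inj; rewrite /= of_baryK push_id //.
  exact: rL (supp_bary x).
Qed.

End Realization.

(** * The circle *)

Section CircleParametrization.
Variable R : realType.
Implicit Types (z : circle R) (s t : R).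

(* The circle is parametrized counterclockwise by [0, 1] so that the abscissa is
   piecewise linear; this avoids trigonometric functions. *)
Definition circle_path_fun s : R * R :=
  let x := 4 * `|clamp s - 1 / 2| - 1 in
  (x, if clamp s <= 1 / 2 then Num.sqrt (1 - x ^+ 2)
      else - Num.sqrt (1 - x ^+ 2)).

Lemma circle_path_subproof s : circle_path_fun s \in @circle_set R.
Proof.
rewrite inE /circle_set /circle_path_fun /=; set x := _ - 1.
have /andP[s0 s1] := clamp_itv s.
have [x_ge x_le] : -1 <= x /\ x <= 1 by rewrite /x; split; case: ler0P; lra.
have x2 : 0 <= 1 - x ^+ 2 by nra.
by case: ifP => _; rewrite ?sqrrN sqr_sqrtr //; lra.
Qed.

Definition circle_path s : circle R := SigSub (circle_path_subproof s).

Lemma circle_pathE s : set_val (circle_path s) = circle_path_fun s.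
Proof. by []. Qed.

Lemma circle_baseE : set_val (circle_base R) = (1, 0).
Proof. by []. Qed.

(** Solves x = 1 - 4s on the upper half and x = 4s - 3 on the lower one. The result jumps at the
    base point, where it is 0 and not 1. *)
Definition circle_pos z : R :=
  let: (x, y) := set_val z in if 0 <= y then (1 - x) / 4 else (3 + x) / 4.

Lemma circleP z : (set_val z).1 ^+ 2 + (set_val z).2 ^+ 2 = 1.
Proof. exact: (set_valP z). Qed.

Lemma circle_eq z z' : set_val z = set_val z' -> z = z'.
Proof. exact: val_inj. Qed.

Lemma circle_path_le0 s : s <= 0 -> circle_path s = circle_base R.
Proof.
move=> s0; apply: circle_eq; rewrite ?circle_pathE ?circle_baseE /circle_path_fun clamp_le0 //.
rewrite sub0r normrN ger0_norm; last by lra.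
rewrite ifT; last by lra.
rewrite (_ : 4 * (1 / 2) - 1 = 1); last by lra.
by rewrite expr1n subrr sqrtr0.
Qed.

Lemma circle_path_ge1 s : 1 <= s -> circle_path s = circle_base R.
Proof.
move=> s1; apply: circle_eq; rewrite ?circle_pathE ?circle_baseE /circle_path_fun clamp_ge1 //.
rewrite ger0_norm; last by lra.
rewrite ifF; last by apply/negbTE; lra.
rewrite (_ : 4 * (1 - 1 / 2) - 1 = 1); last by lra.
by rewrite expr1n subrr sqrtr0 oppr0.
Qed.

Lemma circle_abscissa (x y : R) : x ^+ 2 + y ^+ 2 = 1 -> -1 <= x <= 1.
Proof. by move=> xy; apply/andP; split; nra. Qed.

Lemma circle_pos_itv z : 0 <= circle_pos z <= 1.
Proof.
rewrite /circle_pos; move: (circleP z); case: (set_val z) => x y /= xy.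
have /andP[x_ge x_le] := circle_abscissa xy.
by case: ifP => _; apply/andP; split; lra.
Qed.

Lemma circle_pathK s : 0 <= s < 1 -> circle_pos (circle_path s) = s.
Proof.
move=> /andP[s0 s1]; rewrite /circle_pos circle_pathE /circle_path_fun.
rewrite clamp_id; last by rewrite s0 ltW.
set x := _ - 1; case: (lerP s (1 / 2)) => [s2|s2].
  rewrite ifT ?sqrtr_ge0 // /x ler0_norm; last by lra.
  by lra.
have xE : x = 4 * s - 3 by rewrite /x ger0_norm; lra.
rewrite ifF ?xE; first by lra.
apply/negbTE; rewrite -ltNge oppr_lt0 sqrtr_gt0.
by nra.
Qed.

Lemma circle_posK z : circle_path (circle_pos z) = z.
Proof.
apply: circle_eq; rewrite ?circle_pathE ?circle_baseE /circle_path_fun clamp_id ?circle_pos_itv //.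
rewrite /circle_pos; move: (circleP z); case: (set_val z) => x y /= xy.
have y2 : 1 - x ^+ 2 = y ^+ 2 by lra.
have /andP[x_ge x_le] := circle_abscissa xy.
case: ifP => y0.
  rewrite ler0_norm; last by lra.
  rewrite (_ : 4 * _ - 1 = x); last by lra.
  rewrite ifT; last by lra.
  by rewrite y2 sqrtr_sqr ger0_norm.
have {}y0 : y < 0 by rewrite ltNge y0.
rewrite ger0_norm; last by lra.
rewrite (_ : 4 * _ - 1 = x); last by lra.
rewrite ifF.
  by rewrite y2 sqrtr_sqr ltr0_norm // opprK.
by apply/negbTE; nra.
Qed.

Lemma circle_pos_base : circle_pos (circle_base R) = 0.
Proof. by rewrite -(circle_path_le0 (lexx 0)) circle_pathK // lexx ltr01. Qed.

Lemma set_val1_continuous : continuous (fun z => (set_val z).1 : R).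
Proof. exact: comp_continuous (@set_val_continuous _ _) (@fst_continuous R R). Qed.

Lemma set_val2_continuous : continuous (fun z => (set_val z).2 : R).
Proof. exact: comp_continuous (@set_val_continuous _ _) (@snd_continuous R R). Qed.

Lemma circle_path_continuous : continuous circle_path.
Proof.
pose x s : R := 4 * `|clamp s - 1 / 2| - 1.
have cx : continuous x.
  apply: subf_continuous; last exact: const_continuous.
  apply: mulf_continuous; first exact: const_continuous.
  apply: (@comp_continuous _ _ _ (fun s => clamp s - 1 / 2)); last exact: norm_continuous.
  apply: subf_continuous; [exact: clamp_continuous|exact: const_continuous].
have cy : continuous (fun s => Num.sqrt (1 - x s ^+ 2)).
  apply: (@comp_continuous _ _ _ (fun s => 1 - x s ^+ 2)); last exact: sqrt_continuous.
  apply: subf_continuous; first exact: const_continuous.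
  exact: mulf_continuous.
apply: set_type_continuous.
apply: pair_continuous => //.
pose A (b : bool) : set R :=
  if b then [set s | clamp s <= 1 / 2] else [set s | 1 / 2 <= clamp s].
have cc : continuous (@clamp R) := @clamp_continuous R.
apply: (@closed_cover_continuous _ _ _ A).
- by case; apply: closed_lef => //; exact: const_continuous.
- move=> s; case: (lerP (clamp s) (1 / 2)) => s2; first by exists true.
  by exists false; exact: ltW.
- case; first by apply: eq_within_continuous cy => s /= ->.
  apply: (@eq_within_continuous _ _ _ _ (fun s => - Num.sqrt (1 - x s ^+ 2))).
    move=> s /= s2; case: ifP => // s2'.
    have sE : clamp s = 1 / 2 by lra.
    by rewrite /x sE subrr normr0 mulr0 sub0r sqrrN expr1n subrr sqrtr0 oppr0.
  by move=> s; apply: cvgN; exact: cy.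
Qed.

(** The jump of [circle_pos] at the base point is harmless after a map that identifies 0 with 1. The
    second coordinate is a parameter that lets the lemma serve homotopies too. *)
Lemma circle_pos_comp_continuous (Y : topologicalType) (p : R * R -> Y) :
    continuous p -> (forall t, p (0, t) = p (1, t)) ->
  continuous (fun w : circle R * R => p (circle_pos w.1, w.2)).
Proof.
move=> cp p01; pose X := (circle R * R)%type.
have c1 : continuous (fun w : X => (set_val w.1).1 : R).
  exact: comp_continuous (@fst_continuous _ _) set_val1_continuous.
have c2 : continuous (fun w : X => (set_val w.1).2 : R).
  exact: comp_continuous (@fst_continuous _ _) set_val2_continuous.
have cp' (f : X -> R) : continuous f -> continuous (fun w : X => p (f w, w.2)).
  move=> cf; apply: comp_continuous cp; apply: pair_continuous => //.
  exact: snd_continuous.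
pose A (b : bool) : set X :=
  if b then [set w | 0 <= (set_val w.1).2] else [set w | (set_val w.1).2 <= 0].
apply: (@closed_cover_continuous _ _ _ A).
- by case; apply: closed_lef => //; exact: const_continuous.
- move=> w; case: (lerP 0 (set_val w.1).2) => w0; first by exists true.
  by exists false; exact: ltW.
- case.
    apply: (@eq_within_continuous _ _ _ _ (fun w : X => p ((1 - (set_val w.1).1) / 4, w.2))).
      by move=> [z t] /=; rewrite /circle_pos; case: (set_val z) => x y /= ->.
    apply: cp'; apply: mulf_continuous; last exact: const_continuous.
    by apply: subf_continuous => //; exact: const_continuous.
  apply: (@eq_within_continuous _ _ _ _ (fun w : X => p ((3 + (set_val w.1).1) / 4, w.2))).
    move=> [z t] /=; move: (circleP z); rewrite /circle_pos.
    case: (set_val z) => x y /= xy y0; case: ifP => // y0'.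
    (* Here the ordinate is 0. The two formulas agree at (-1, 0), with value 1/2, and at the base
       point they give 0 and 1, which [p01] identifies. *)
    have x2 : x ^+ 2 = 1 by nra.
    have /orP[/eqP->|/eqP->] : (x == 1) || (x == -1) by rewrite -sqrf_eq1 x2.
      by rewrite subrr mul0r p01; do 2 f_equal; lra.
    by do 2 f_equal; lra.
  apply: cp'; apply: mulf_continuous; last exact: const_continuous.
  by apply: addf_continuous => //; exact: const_continuous.
Qed.

Lemma closed_circle_base : closed [set circle_base R].
Proof.
rewrite (_ : [set _] = [set z | (set_val z).1 = (1 : R)]).
  by apply: closed_eqf; [exact: set_val1_continuous|exact: const_continuous].
apply/seteqP; split=> z /= => [->//|z1]; apply: circle_eq.
move: (circleP z) z1; case: (set_val z) => x y /= xy x1; congr pair => //.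
by apply/eqP; rewrite -sqrf_eq0; apply/eqP; nra.
Qed.

End CircleParametrization.

(** * Attaching edges to a contractible complex *)

Lemma subset_pair (V : finType) (c : {set V}) (a b : V) :
    c \subset [set a; b]%SET -> c != finset.set0 ->
  [\/ c = [set a]%SET, c = [set b]%SET | c = [set a; b]%SET].
Proof.
move=> /fintype.subsetP sc /set0Pn[w wc].
have [ac|ac] := boolP (a \in c); have [bc|bc] := boolP (b \in c).
- by constructor 3; apply/setP => w'; apply/idP/idP => [/sc //|]; rewrite !inE => /orP[]/eqP->.
- constructor 1; apply/setP => w'; rewrite inE; apply/idP/eqP => [w'c|-> //].
  by have := sc _ w'c; rewrite !inE => /orP[]/eqP // w'b; rewrite -w'b w'c in bc.
- constructor 2; apply/setP => w'; rewrite inE; apply/idP/eqP => [w'c|-> //].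
  by have := sc _ w'c; rewrite !inE => /orP[]/eqP // w'a; rewrite -w'a w'c in ac.
- by have := sc _ wc; rewrite !inE => /orP[]/eqP wE; [move: ac|move: bc]; rewrite -wE wc.
Qed.

Definition attach_edges (V : finType) (L : {set {set V}}) (n : nat)
    (u v : 'I_n -> V) : {set {set V}} :=
  L :|: [set [set u j; v j] | j : 'I_n]%SET.

Section AttachEdges.
Variables (R : realType) (V : finType) (L : {set {set V}}) (m : nat).
Variables u v : 'I_m.+1 -> V.

Hypothesis simplL : simplicial L.
Hypothesis uL : forall j, [set u j]%SET \in L.
Hypothesis vL : forall j, [set v j]%SET \in L.
Hypothesis edgeNL : forall j, [set u j; v j]%SET \notin L.
Hypothesis edge_inj : injective (fun j => [set u j; v j]%SET).

Local Notation K := (attach_edges L u v).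
Local Notation W := (wedge_of_circles R m.+1).
Implicit Types (x : realization R K) (s t : R) (j : 'I_m.+1).

Variables (c0 : realization R L) (rho : realization R L * R -> realization R L).
Hypothesis rho_continuous : continuous rho.
Hypothesis rho0 : forall y, rho (y, 0) = y.
Hypothesis rho1 : forall y, rho (y, 1) = c0.

Let uv_neq j : u j != v j.
Proof. by apply: contra (edgeNL j) => /eqP <-; rewrite finset.setUid. Qed.

Let edgeK j : [set u j; v j]%SET \in K.
Proof. by rewrite inE; apply/orP; right; apply/imsetP; exists j. Qed.

Let edge_face j : face_closed K [set u j; v j]%SET.
Proof.
by move=> c sc cN0; case: (subset_pair sc cN0) => -> //; rewrite inE ?uL ?vL.
Qed.

Fact incl_subproof (y : realization R L) : realization_set K (bary y).
Proof. by have [y0 y1 yL] := baryP y; split=> //; rewrite inE yL. Qed.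

Let incl y : realization R K := of_bary (incl_subproof y).

Let incl_continuous : continuous incl.
Proof. by apply: realization_continuous => w; exact: bary_continuous. Qed.

Fact vertex_subproof (w : V) : [set w]%SET \in L ->
  realization_set L (fun w' => (w' == w)%:R : R).
Proof.
move=> wL; split=> [w'||]; first exact: ler0n.
  by rewrite (bigD1 w) //= eqxx big1 ?addr0 // => w' /negbTE ->.
rewrite (_ : [set _ | _]%SET = [set w]%SET) //.
by apply/setP => w'; rewrite !inE pnatr_eq0 eqb0 negbK.
Qed.

Let vertex (w : V) (wL : [set w]%SET \in L) : realization R L :=
  of_bary (vertex_subproof wL).

Definition edge_fun j s : V -> R :=
  fun w => (1 - clamp s) * (w == u j)%:R + clamp s * (w == v j)%:R.

Fact edge_subproof j s : realization_set K (edge_fun j s).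
Proof.
have /andP[s0 s1] := clamp_itv s.
have sum1 (w : V) : \sum_w' ((w' == w)%:R : R) = 1.
  by rewrite (bigD1 w) //= eqxx big1 ?addr0 // => w' /negbTE ->.
apply: (realization_setP (@edge_face j)) => [w||].
- by rewrite addr_ge0 // mulr_ge0 ?ler0n ?subr_ge0.
- by rewrite big_split /= -!mulr_sumr !sum1; lra.
- apply: fintype.subset_trans (supp_segment _ _ _) _.
  apply/fintype.subsetP => w; rewrite !inE !pnatr_eq0 !eqb0 !negbK.
  by [].
Qed.

Let edge j s : realization R K := of_bary (edge_subproof j s).

Let bary_edge j s : bary (edge j s) = edge_fun j s.
Proof. by []. Qed.

Let bary_incl y : bary (incl y) = bary y.
Proof. by []. Qed.

Let bary_vertex (w : V) (wL : [set w]%SET \in L) :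
  bary (vertex wL) = fun w' => (w' == w)%:R.
Proof. by []. Qed.

Let edge_continuous j : continuous (edge j).
Proof.
apply: realization_continuous => w.
apply: addf_continuous; apply: mulf_continuous; try exact: const_continuous.
  apply: subf_continuous; first exact: const_continuous.
  exact: clamp_continuous.
exact: clamp_continuous.
Qed.

(* The j-th edge, on [0, 1], extended to [-1, 2] by the tracks of its ends under
   the contraction. *)
Definition track j s : realization R K :=
  if s <= 0 then incl (rho (vertex (uL j), clamp (- s)))
  else if s <= 1 then edge j s
  else incl (rho (vertex (vL j), clamp (s - 1))).

Let track_le0 j s : s <= 0 -> track j s = incl (rho (vertex (uL j), clamp (- s))).
Proof. by rewrite /track => ->. Qed.

Let track_ge1 j s : 1 <= s -> track j s = incl (rho (vertex (vL j), clamp (s - 1))).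
Proof.
move=> s1; rewrite /track ifF; last by apply/negbTE; lra.
case: ifP => // s1'; have -> : s = 1 by lra.
rewrite subrr clamp_le0 // rho0; apply: bary_inj; apply/funext => w.
by rewrite bary_edge bary_incl bary_vertex /edge_fun clamp_ge1 // subrr mul0r add0r mul1r.
Qed.

Let track_edge j s : 0 <= s <= 1 -> track j s = edge j s.
Proof.
move=> /andP[s0 s1]; rewrite /track s1; case: ifP => // s0'.
have -> : s = 0 by lra.
rewrite oppr0 clamp_le0 // rho0; apply: bary_inj; apply/funext => w.
by rewrite bary_edge bary_incl bary_vertex /edge_fun clamp_le0 // subr0 mul0r addr0 mul1r.
Qed.

Let track_continuous j : continuous (track j).
Proof.
have crho (y : realization R L) (f : R -> R) :
    continuous f -> continuous (fun s => incl (rho (y, clamp (f s)))).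
  move=> cf; apply: comp_continuous incl_continuous.
  apply: comp_continuous rho_continuous; apply: pair_continuous.
    exact: const_continuous.
  exact: clampf_continuous.
have cid : continuous (fun s => s) by move=> s; exact: cvg_id.
pose A (o : option bool) : set R :=
  match o with
  | Some true => [set s | s <= 0]
  | Some false => [set s | 1 <= s]
  | None => [set s | 0 <= s] `&` [set s | s <= 1]
  end.
apply: (@closed_cover_continuous _ _ _ A).
- by move=> [[]|]; [| |apply: closedI]; apply: closed_lef => //; exact: const_continuous.
- move=> s; case: (lerP s 0) => s0; first by exists (Some true).
  case: (lerP s 1) => s1; last by exists (Some false); exact: ltW.
  by exists None; split=> //=; exact: ltW.
- move=> [[]|].
  + apply: (@eq_within_continuous _ _ _ _ _ (track_le0 j)).
    by apply: crho => s; apply: cvgN; exact: cvg_id.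
  + apply: (@eq_within_continuous _ _ _ _ _ (track_ge1 j)); apply: crho.
    by apply: subf_continuous => //; exact: const_continuous.
  + apply: (@eq_within_continuous _ _ _ _ (edge j)) => [s [s0 s1]|//].
    by rewrite track_edge //; apply/andP.
Qed.

(** The part of the complex coming from [L], written as a zero set so that it is visibly closed. For
    the same reason [edge_piece] below is given by an equation; it is the closed edge, with its
    ends. *)
Let tail_piece : set (realization R K) :=
  [set x | forall j, bary x (u j) * bary x (v j) = 0].

Let edge_piece j : set (realization R K) :=
  [set x | bary x (u j) + bary x (v j) = 1].

Let tail_piece_supp x : tail_piece x -> supp (bary x) \in L.
Proof.
move=> xT; have := supp_bary x; rewrite inE => /orP[//|/imsetP[j _ xj]].
have := xT j; move/eqP; rewrite mulf_eq0 => /orP[] x0.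
  by have : u j \in supp (bary x) by [rewrite xj !inE eqxx]; rewrite inE x0.
by have : v j \in supp (bary x) by [rewrite xj !inE eqxx orbT]; rewrite inE x0.
Qed.

(** The support contains both ends of the edge. It is not a face of [L], since [L] is simplicial and
    lacks the edge; so it is an attached pair, and equality follows by counting. *)
Let prod_edge x j : bary x (u j) * bary x (v j) != 0 ->
  supp (bary x) = [set u j; v j]%SET.
Proof.
rewrite mulf_eq0 negb_or => /andP[xu xv].
have sub : [set u j; v j]%SET \subset supp (bary x).
  by rewrite finset.subUset !finset.sub1set !inE xu.
have := supp_bary x; rewrite inE => /orP[xL|/imsetP[i _ xi]].
  have : [set u j; v j]%SET \in L.
    by apply: simplL xL _ sub _; apply/set0Pn; exists (u j); rewrite !inE eqxx.
  by rewrite (negbTE (edgeNL j)).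
by apply/eqP; rewrite eq_sym eqEcard sub xi !cards2 !uv_neq.
Qed.

Let supp_edge_piece x j :
  supp (bary x) = [set u j; v j]%SET -> edge_piece j x.
Proof.
move=> xj; rewrite /edge_piece /= -(bary_sum x) (bigD1 (u j)) //=.
rewrite (bigD1 (v j)) /=; last by rewrite eq_sym uv_neq.
rewrite big1 ?addr0 // => w /andP[wu wv].
have : w \notin supp (bary x) by rewrite xj !inE negb_or wu.
by rewrite inE negbK => /eqP.
Qed.

Let edge_pieceE j x : edge_piece j x -> x = edge j (bary x (v j)).
Proof.
move=> xj; have xvs : 0 <= bary x (v j) <= 1.
  have := bary_ge0 x (u j); have := bary_ge0 x (v j).
  by move: xj; rewrite /edge_piece /= => ? ? ?; apply/andP; split; lra.
apply: bary_inj; apply/funext => w; rewrite bary_edge /edge_fun clamp_id //.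
have [->|wu] := eqVneq w (u j).
  rewrite (negbTE (uv_neq j)) mulr1 mulr0 addr0.
  by move: xj; rewrite /edge_piece /=; lra.
have [->|wv] := eqVneq w (v j); first by rewrite mulr0 mulr1 add0r.
rewrite !mulr0 addr0.
have := bary_sum x; rewrite (bigD1 (u j)) //= (bigD1 (v j)) /=; last first.
  by rewrite eq_sym uv_neq.
rewrite addrA xj => /(congr1 (fun r => r - 1)) /=; rewrite subrr addrAC subrr add0r => sum0.
have := @psumr_eq0P _ _ _ (bary x) _ sum0 w; apply; last by rewrite wu wv.
by move=> *; exact: bary_ge0.
Qed.

(** The support of [x] contains the [i]-th pair and lies in the [j]-th one, and both have two
    elements. *)
Let edge_piece_uniq x i j : edge_piece j x ->
  bary x (u i) * bary x (v i) != 0 -> i = j.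
Proof.
move=> xj /prod_edge xi; apply: edge_inj => /=; apply/eqP.
rewrite eqEcard !cards2 !uv_neq leqnn andbT -xi.
apply/fintype.subsetP => w; rewrite !inE; apply: contraR; rewrite negb_or.
move=> /andP[/negbTE wu /negbTE wv].
by rewrite (edge_pieceE xj) bary_edge /edge_fun wu wv !mulr0 addr0.
Qed.

(** The attached edge whose open interior contains [x]; the value [None] describes the tail piece,
    ends of edges included. *)
Definition pick_edge x : option 'I_m.+1 :=
  [pick j | bary x (u j) * bary x (v j) != 0].

Let pick_tail x : tail_piece x -> pick_edge x = None.
Proof.
by move=> xT; rewrite /pick_edge; case: pickP => // j; rewrite xT eqxx.
Qed.

Let pick_edge_piece j x : edge_piece j x ->
  [\/ pick_edge x = Some j,
      [/\ pick_edge x = None, bary x (u j) = 1 & bary x (v j) = 0]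
    | [/\ pick_edge x = None, bary x (u j) = 0 & bary x (v j) = 1]].
Proof.
move=> xj; rewrite /pick_edge; case: pickP => [i /(edge_piece_uniq xj) ->|/(_ j)].
  by constructor 1.
move/negbFE; rewrite mulf_eq0; move: xj; rewrite /edge_piece /= => xj /orP[]/eqP x0.
  by constructor 3; split=> //; rewrite -xj x0 add0r.
by constructor 2; split=> //; rewrite -xj x0 addr0.
Qed.

Let pick_edgeP x j : pick_edge x = Some j -> edge_piece j x /\ 0 < bary x (v j) < 1.
Proof.
rewrite /pick_edge; case: pickP => // i xi [<-].
have xij := supp_edge_piece (prod_edge xi); split=> //.
move: xi; rewrite mulf_eq0 negb_or => /andP[xu xv].
have := bary_ge0 x (u i); have := bary_ge0 x (v i).
rewrite !le_eqVlt ![0 == _]eq_sym (negbTE xu) (negbTE xv) /= => ? ?.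
by move: xij; rewrite /edge_piece /= => ?; apply/andP; split; lra.
Qed.

Let pieces_cover x : tail_piece x \/ exists j, edge_piece j x.
Proof.
case E : (pick_edge x) => [j|]; first by right; exists j; case/pick_edgeP: E.
left=> j; move: E; rewrite /pick_edge; case: pickP => // /(_ j) /negbFE /eqP.
by [].
Qed.

(** The map [p] lets one finite closed cover serve both the complex and its product with the time
    axis. *)
Let pieces (X : topologicalType) (p : X -> realization R K)
    (o : option 'I_m.+1) : set X :=
  if o is Some j then [set z | edge_piece j (p z)] else [set z | tail_piece (p z)].

Let pieces_continuous (X Y : topologicalType) (p : X -> realization R K) (f : X -> Y) :
  continuous p -> (forall o, {within pieces p o, continuous f}) -> continuous f.
Proof.
move=> cp cf; have cbary w : continuous (fun z => bary (p z) w).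
  exact: comp_continuous cp (@bary_continuous _ _ _ w).
apply: closed_cover_continuous cf => [[j|]|z].
- apply: closed_eqf; last exact: const_continuous.
  by apply: addf_continuous; exact: cbary.
- rewrite (_ : pieces _ _ = \bigcap_(j in [set: 'I_m.+1])
      [set z | bary (p z) (u j) * bary (p z) (v j) = 0]); last first.
    by apply/seteqP; split=> z /= zT => [j _|j]; exact: zT.
  apply: closed_bigI => j _; apply: closed_eqf; last exact: const_continuous.
  by apply: mulf_continuous; exact: cbary.
- by case: (pieces_cover (p z)) => [zT|[j zj]]; [exists None|exists (Some j)].
Qed.

(** A total inverse of [incl]; the default [c0] is met only off the tail piece. *)
Definition to_tail x : realization R L :=
  if pselect (realization_set L (bary x)) is left xL then of_bary xL else c0.

Let to_tailE x : tail_piece x -> bary (to_tail x) = bary x.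
Proof.
move=> /tail_piece_supp xL; rewrite /to_tail; case: pselect => //; case.
by have [x0 x1 _] := baryP x; split.
Qed.

Let to_tail_vertex (w : V) (wL : [set w]%SET \in L) x : bary x w = 1 ->
  to_tail x = vertex wL.
Proof.
move=> xw; have xE : bary x = fun w' => (w' == w)%:R.
  apply/funext => w'; have [->//|ww] := eqVneq w' w.
  have := bary_sum x; rewrite (bigD1 w) //= xw.
  move=> /(congr1 (fun r => r - 1)) /=; rewrite subrr addrAC subrr add0r => sum0.
  have := @psumr_eq0P _ _ _ (bary x) _ sum0 w'; apply => //.
  by move=> *; exact: bary_ge0.
apply: bary_inj; rewrite bary_vertex /to_tail; case: pselect => [xL|]; first exact: xE.
by case; rewrite xE; exact: vertex_subproof.
Qed.

Definition petal j : circle R -> W :=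
  @wedge_lift _ _ (fun _ : 'I_m.+1 => circle_base R) j.

Let petal_continuous j : continuous (petal j).
Proof. exact: (@wedge_lift_continuous _ _ (fun _ : 'I_m.+1 => circle_base R) j). Qed.

(** Crushes [L] to the base point and wraps each edge once around its circle. The index [ord0] is an
    arbitrary choice, because all petals share the base point. *)
Definition collapse x : W :=
  if pick_edge x is Some j then petal j (circle_path (bary x (v j)))
  else petal ord0 (circle_base R).

Let petal_base i j : petal i (circle_base R) = petal j (circle_base R).
Proof.
exact: (@wedge_liftE _ _ (fun=> circle_base R) j (circle_base R) i (circle_base R)).
Qed.

Let petal_surj (w : W) : exists j z, w = petal j z.
Proof.
have : [set: wedge (fun _ : 'I_m.+1 => circle_base R)] w by [].
by rewrite -wedgeTE => -[j _ [z _ <-]]; exists j, z.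
Qed.

Let collapse_edge j x : edge_piece j x ->
  collapse x = petal j (circle_path (bary x (v j))).
Proof.
rewrite /collapse => /pick_edge_piece[->//|[-> _ ->]|[-> _ ->]].
  by rewrite circle_path_le0 //; exact: petal_base.
by rewrite circle_path_ge1 //; exact: petal_base.
Qed.

Let collapse_tail x : tail_piece x -> collapse x = petal ord0 (circle_base R).
Proof. by rewrite /collapse => /pick_tail ->. Qed.

Let collapse_continuous : continuous collapse.
Proof.
apply: (@pieces_continuous _ _ idfun) => [x|[j|]]; first exact: cvg_id.
  apply: (@eq_within_continuous _ _ _ _ (fun x => petal j (circle_path (bary x (v j))))).
    exact: collapse_edge.
  apply: comp_continuous (@petal_continuous j).
  apply: comp_continuous (@circle_path_continuous R).
  exact: bary_continuous.
apply: eq_within_continuous collapse_tail _.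
exact: const_continuous.
Qed.

(** The affine map sends the position in [0, 1] to [-1, 2]: a third of the circle runs from [c0] to
    one end of the edge, a third along the edge, a third back to [c0]. *)
Definition wind : W -> realization R K :=
  wedge_fun (fun j z => track j (3 * circle_pos z - 1)).

Let track_base j t : 0 <= t <= 1 -> 
  track j (- t) = incl (rho (vertex (uL j), t)) /\
  track j (1 + t) = incl (rho (vertex (vL j), t)).
Proof.
move=> t01; have /andP[t0 t1] := t01.
rewrite track_le0 ?oppr_le0 // opprK track_ge1 ?lerDl //.
by rewrite (addrC 1) addrK clamp_id.
Qed.

Let track_ends j : track j (-1) = incl c0 /\ track j 2 = incl c0.
Proof.
have [|-> tr] := @track_base j 1; first by rewrite ler01 lexx.
by rewrite (_ : 2 = 1 + 1) // tr !rho1.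
Qed.

Let wind_base i j : track i (3 * circle_pos (circle_base R) - 1) =
  track j (3 * circle_pos (circle_base R) - 1).
Proof.
by rewrite circle_pos_base mulr0 sub0r (track_ends i).1 (track_ends j).1.
Qed.

Let wind_lift j (z : circle R) :
  wind (petal j z) = track j (3 * circle_pos z - 1).
Proof. by rewrite /wind wedge_lift_funE. Qed.

Let wind_continuous : continuous wind.
Proof.
apply: wedge_fun_continuous => // j.
have cp : continuous (fun z : R * R => track j (3 * z.1 - 1)).
  apply: comp_continuous (@track_continuous j).
  apply: subf_continuous; last exact: const_continuous.
  by apply: mulf_continuous; [exact: const_continuous|exact: fst_continuous].
have /= cpos := @circle_pos_comp_continuous R _ _ cp.
have cz : continuous (fun z : circle R => (z, 0 : R)).
  by apply: pair_continuous; [move=> z; exact: cvg_id|exact: const_continuous].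
apply: (comp_continuous cz (cpos _)) => t.
rewrite mulr0 sub0r (track_ends j).1 mulr1 (_ : 3 - 1 = 2) ?(track_ends j).2 //.
by lra.
Qed.

(* At time t the track is read on [-t, 1 + t]. *)
Definition spread t s : R := (1 + 2 * clamp t) * s - clamp t.

Let spread_continuous (X : topologicalType) (f g : X -> R) :
  continuous f -> continuous g -> continuous (fun z : X => spread (f z) (g z)).
Proof.
move=> cf cg; have ccf := clampf_continuous cf.
apply: subf_continuous => //; apply: mulf_continuous => //.
apply: addf_continuous; first exact: const_continuous.
by apply: mulf_continuous => //; exact: const_continuous.
Qed.

Let spread0 t : spread t 0 = - clamp t.
Proof. by rewrite /spread mulr0 sub0r. Qed.

Let spread1 t : spread t 1 = 1 + clamp t.
Proof. by rewrite /spread mulr1; lra. Qed.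

Let spread_t0 s : spread 0 s = s.
Proof. by rewrite /spread clamp_le0 // mulr0 addr0 mul1r subr0. Qed.

Let spread_t1 s : spread 1 s = 3 * s - 1.
Proof. by rewrite /spread clamp_ge1 //; lra. Qed.

(** The homotopy from the identity to [wind \o collapse]. It contracts [L] while each edge is read
    on a growing part of its track; at an end of an edge both descriptions follow the contraction of
    that end. *)
Definition stretch (z : realization R K * R) : realization R K :=
  if pick_edge z.1 is Some j then track j (spread z.2 (bary z.1 (v j)))
  else incl (rho (to_tail z.1, clamp z.2)).

Let stretch_edge j z : edge_piece j z.1 ->
  stretch z = track j (spread z.2 (bary z.1 (v j))).
Proof.
rewrite /stretch; case: z => x t /=.
have [tru trv] := @track_base j _ (clamp_itv t).
case/pick_edge_piece=> [->//|[-> xu ->]|[-> _ xv]].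
  by rewrite spread0 tru (to_tail_vertex (uL j)).
by rewrite xv spread1 trv (to_tail_vertex (vL j)).
Qed.

Let stretch_tail z : tail_piece z.1 ->
  stretch z = incl (rho (to_tail z.1, clamp z.2)).
Proof. by rewrite /stretch => /pick_tail ->. Qed.

Let stretch_continuous : continuous stretch.
Proof.
pose X := (realization R K * R)%type.
have c1 : continuous (fun z : X => z.1) by exact: fst_continuous.
have c2 : continuous (fun z : X => z.2) by exact: snd_continuous.
apply: (@pieces_continuous _ _ (fun z : X => z.1)) => // [[j|]].
  apply: eq_within_continuous (@stretch_edge j) _.
  apply: comp_continuous (@track_continuous j); apply: spread_continuous => //.
  exact: comp_continuous c1 (@bary_continuous _ _ _ _).
(* No continuous formula on the whole space extends [to_tail], so continuity is checked on the
   subspace itself, where its coordinates are those of the point. *)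
apply/subspace_sigL_continuousP.
pose A := pieces (fun z : X => z.1) None.
have cA : continuous (fun a : A => set_val a) by exact: set_val_continuous.
rewrite (_ : sigL _ _ = fun a : A => incl (rho (to_tail (set_val a).1, clamp (set_val a).2))).
  apply: comp_continuous incl_continuous; apply: comp_continuous rho_continuous.
  apply: pair_continuous; last first.
    by apply: clampf_continuous; exact: comp_continuous cA c2.
  apply: realization_continuous => w.
  rewrite (_ : (fun _ => _) = fun a : A => bary (set_val a).1 w).
    apply: (@comp_continuous _ _ _ _ (fun z : X => bary z.1 w) cA).
    exact: comp_continuous c1 (@bary_continuous _ _ _ _).
  by apply/funext => a; rewrite to_tailE //; exact: (set_valP a).
by apply/funext => a; apply: stretch_tail; exact: (set_valP a).
Qed.

Let stretch0 x : stretch (x, 0) = x.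
Proof.
case: (pieces_cover x) => [xT|[j xj]].
  rewrite stretch_tail //= clamp_le0 // rho0; apply: bary_inj.
  exact: to_tailE.
rewrite (stretch_edge (j := j)) //= spread_t0 track_edge -?edge_pieceE //.
have := bary_ge0 x (u j); have := bary_ge0 x (v j).
by move: xj; rewrite /edge_piece /= => ? ? ?; apply/andP; split; lra.
Qed.

Let stretch1 x : stretch (x, 1) = wind (collapse x).
Proof.
rewrite /stretch /collapse /=; case E : (pick_edge x) => [j|].
  have [_ /andP[x0 x1]] := pick_edgeP E.
  by rewrite wind_lift circle_pathK ?spread_t1 // x1 ltW.
rewrite wind_lift circle_pos_base mulr0 sub0r (track_ends ord0).1.
by rewrite clamp_ge1 // rho1.
Qed.

Let tail_incl y : tail_piece (incl y).
Proof.
move=> j; apply/eqP/negPn/negP => /prod_edge yj.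
by have := supp_bary y; rewrite -[bary y]/(bary (incl y)) yj (negbTE (edgeNL j)).
Qed.

(** Outside [0, 1] the track lies in [L], and there [circle_path] rests at the base point. *)
Let collapse_track j s : collapse (track j s) = petal j (circle_path s).
Proof.
have [s0|s0] := lerP s 0.
  by rewrite track_le0 // collapse_tail // circle_path_le0 //; exact: petal_base.
have [s1|s1] := lerP 1 s.
  by rewrite track_ge1 // collapse_tail // circle_path_ge1 //; exact: petal_base.
have s01 : 0 <= s <= 1 by rewrite !ltW.
have bv : bary (edge j s) (v j) = s.
  by rewrite bary_edge /edge_fun clamp_id // eqxx eq_sym (negbTE (uv_neq j)) mulr0 add0r mulr1.
rewrite track_edge // (@collapse_edge j) ?bv //.
rewrite /edge_piece /= bv bary_edge /edge_fun clamp_id // eqxx.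
by rewrite (negbTE (uv_neq j)) mulr0 addr0 mulr1 subrK.
Qed.

(** The homotopy from the identity of the wedge to [collapse \o wind], petal by petal: the loop is
    traversed faster and waits at the base point before and after. *)
Definition rewind (j : 'I_m.+1) (t : R) (z : circle R) : W :=
  petal j (circle_path (spread t (circle_pos z))).

Let rewind_base t i j : rewind i t (circle_base R) = rewind j t (circle_base R).
Proof.
rewrite /rewind circle_pos_base spread0.
have /andP[t0 _] := clamp_itv t.
by rewrite circle_path_le0 ?oppr_le0 //; exact: petal_base.
Qed.

Let rewind_continuous j : continuous (uncurry (rewind j)).
Proof.
have cp : continuous (fun z : R * R => petal j (circle_path (spread z.2 z.1)) : W).
  apply: comp_continuous (@petal_continuous j).
  apply: comp_continuous (@circle_path_continuous R).
  by apply: spread_continuous; [exact: snd_continuous|exact: fst_continuous].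
have cs : continuous (fun z : R * circle R => (z.2, z.1)).
  by apply: pair_continuous; [exact: snd_continuous|exact: fst_continuous].
have /= cpos := @circle_pos_comp_continuous R _ _ cp.
have := comp_continuous cs (cpos _).
rewrite (_ : uncurry _ = fun z : R * circle R =>
  petal j (circle_path (spread z.1 (circle_pos z.2)))); last first.
  by apply/funext => -[].
apply=> t; rewrite spread0 spread1; have /andP[t0 _] := clamp_itv t.
by rewrite circle_path_le0 ?oppr_le0 // circle_path_ge1 // lerDl.
Qed.

Lemma attach_edges_equivalent : homotopy_equivalent R (realization R K) W.
Proof.
exists collapse, wind; split => //.
  apply/homotopic_sym/homotopicP; exists stretch; split=> //.
apply/homotopic_sym/homotopicP.
pose H (t : R) : W -> W := wedge_fun (fun j => rewind j t).
exists (fun z => H z.2 z.1); split=> [|w|w].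
- have cs : continuous (fun z : W * R => (z.2, z.1)).
    by apply: pair_continuous; [exact: snd_continuous|exact: fst_continuous].
  (* Joint continuity in time and point on the wedge rests on the finiteness of the family and on
     the base points being closed. *)
  apply: (comp_continuous cs (@wedge_fun_joint_continuous _ _ _ _ _ rewind _ _ _ _)) => //.
    exact: finite_finset.
  by move=> _; exact: closed_circle_base.
- have [j [z ->]] := petal_surj w.
  by rewrite /H wedge_lift_funE // /rewind spread_t0 circle_posK.
- have [j [z ->]] := petal_surj w.
  by rewrite /H wedge_lift_funE // /rewind spread_t1 [RHS]/= wind_lift collapse_track.
Qed.

End AttachEdges.

Theorem attach_edges_wedge (R : realType) (V : finType) (L : {set {set V}})
    (n : nat) (u v : 'I_n -> V) :
    simplicial L ->
    (forall j, [set u j]%SET \in L) -> (forall j, [set v j]%SET \in L) ->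
    (forall j, [set u j; v j]%SET \notin L) ->
    injective (fun j => [set u j; v j]%SET) ->
    contractible R (realization R L) ->
  homotopy_equivalent R (realization R (attach_edges L u v)) (wedge_of_circles R n).
Proof.
case: n u v => [|m] u v simplL uL vL uvL uv_inj cL.
  (* Without edges the complex is [L], and the wedge of no circles is a point. *)
  suff -> : attach_edges L u v = L by [].
  apply/setP => c; rewrite inE orb_idr // => /imsetP[[]].
  by [].
have [c0 [rho [crho rho0 rho1]]] := contractible_contraction cL.
exact: (attach_edges_equivalent simplL uL vL uvL uv_inj crho rho0 rho1).
Qed.

(** * Connected graphs *)

Section Graph.
Variables (R : realType) (V : finType).
Implicit Types (A B : {set V}) (D E : {set V * V}) (e : V * V).

Definition graph_complex A E : {set {set V}} :=
  [set [set w] | w in A]%SET :|: [set [set e.1; e.2] | e in E]%SET.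

Lemma graph_complexP A E c :
  reflect ((exists2 w, w \in A & c = [set w]%SET) \/
           (exists2 e, e \in E & c = [set e.1; e.2]%SET))
          (c \in graph_complex A E).
Proof.
rewrite inE; apply: (iffP orP) => -[].
- by move=> /imsetP[w wA ->]; left; exists w.
- by move=> /imsetP[e eE ->]; right; exists e.
- by move=> [w wA ->]; left; apply/imsetP; exists w.
- by move=> [e eE ->]; right; apply/imsetP; exists e.
Qed.

Lemma graph_complex_vertex A E w : w \in A -> [set w]%SET \in graph_complex A E.
Proof. by move=> wA; apply/graph_complexP; left; exists w. Qed.

Lemma graph_complex_edge A E e :
  e \in E -> [set e.1; e.2]%SET \in graph_complex A E.
Proof. by move=> eE; apply/graph_complexP; right; exists e. Qed.

Definition edges_within A E := forall e, e \in E -> e.1 \in A /\ e.2 \in A.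

Lemma graph_complex_sub A E c w : edges_within A E ->
  c \in graph_complex A E -> w \in c -> w \in A.
Proof.
move=> EA /graph_complexP[[w' w'A ->]|[e /EA[e1 e2] ->]].
  by rewrite inE => /eqP->.
by rewrite !inE => /orP[]/eqP->.
Qed.

Lemma graph_complex_simplicial A E :
  edges_within A E -> simplicial (graph_complex A E).
Proof.
move=> EA c /graph_complexP[[w wA ->]|[e eE ->]] c' sc' cN0.
  move: sc'; rewrite finset.subset1 (negbTE cN0) orbF => /eqP->.
  exact: graph_complex_vertex.
have [e1 e2] := EA _ eE.
by case: (subset_pair sc' cN0) => ->; [| |exact: graph_complex_edge];
   exact: graph_complex_vertex.
Qed.

Lemma realization_point (w : V) :
  contractible R (realization R (graph_complex [set w]%SET finset.set0)).
Proof.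
set K := graph_complex _ _.
have wP : realization_set K (fun w' => (w' == w)%:R : R).
  split=> [w'||]; first exact: ler0n.
    by rewrite (bigD1 w) //= eqxx big1 ?addr0 // => w' /negbTE ->.
  rewrite (_ : [set _ | _]%SET = [set w]%SET); last first.
    by apply/setP => w'; rewrite !inE pnatr_eq0 eqb0 negbK.
  by apply: graph_complex_vertex; rewrite inE.
exists (fun=> tt), (fun=> of_bary wP); split.
- exact: const_continuous.
- exact: const_continuous.
- rewrite (_ : _ \o _ = idfun); first by apply: homotopic_refl => x; exact: cvg_id.
  apply/funext => x; apply: bary_inj; apply/funext => w'.
  rewrite -[LHS]/((w' == w)%:R).
  have x0 w'' : w'' != w -> bary x w'' = 0.
    move=> ww; apply/eqP/negPn/negP => xw.
    have : w'' \in [set w]%SET.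
      apply: (@graph_complex_sub _ finset.set0 (supp (bary x))) => [e||].
      + by rewrite finset.in_set0.
      + exact: supp_bary.
      + by rewrite inE.
    by rewrite inE (negbTE ww).
  have [->|ww] := eqVneq w' w; last by rewrite x0 // (negbTE ww).
  by rewrite -(bary_sum x) (bigD1 w) //= big1 ?addr0 ?eqxx.
- rewrite (_ : _ \o _ = idfun); first by apply: homotopic_refl => x; exact: cvg_id.
  by apply/funext => -[].
Qed.

(** Sliding the leaf [b] along its only edge to [a] is a vertex retraction. The edge is given as an
    unordered pair, so its orientation in [E] does not matter. *)
Lemma graph_complex_leaf A E e a b : edges_within A E -> a \in A -> b \notin A ->
    [set e.1; e.2]%SET = [set a; b]%SET ->
  homotopy_equivalent R (realization R (graph_complex (b |: A)%SET (e |: E)%SET))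
                        (realization R (graph_complex A E)).
Proof.
move=> EA aA bA eab; pose r w := if w == b then a else w.
have rA w : w \in A -> r w = w.
  by rewrite /r; case: eqP => // ->; rewrite (negbTE bA).
have rb : r b = a by rewrite /r eqxx.
have rid c : c \in graph_complex A E -> r @: c = c.
  move=> cK; rewrite -[RHS]imset_id; apply: eq_in_imset => w wc.
  exact/rA/(graph_complex_sub EA cK wc).
have LK : graph_complex A E \subset graph_complex (b |: A)%SET (e |: E)%SET.
  apply/fintype.subsetP => c /graph_complexP[[w wA ->]|[e' eE ->]].
    by apply: graph_complex_vertex; rewrite !inE wA orbT.
  by apply: graph_complex_edge; rewrite !inE eE orbT.
have simplK : simplicial (graph_complex (b |: A)%SET (e |: E)%SET).
  apply: graph_complex_simplicial => e' /setU1P[->|/EA[e1 e2]].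
    have := finset.set21 e.1 e.2; have := finset.set22 e.1 e.2; rewrite eab !inE.
    by move=> /orP[]/eqP-> /orP[]/eqP->; rewrite ?eqxx ?aA ?orbT.
  by rewrite !inE e1 e2 !orbT.
have abK : [set a; b]%SET \in graph_complex (b |: A)%SET (e |: E)%SET.
  by rewrite -eab; apply: graph_complex_edge; rewrite !inE eqxx.
have casesK c : c \in graph_complex (b |: A)%SET (e |: E)%SET ->
    [\/ c \in graph_complex A E, c = [set b]%SET | c = [set a; b]%SET].
  move=> /graph_complexP[[w /setU1P[->|wA] ->]|[e' /setU1P[->|eE] ->]].
  - by constructor 2.
  - by constructor 1; exact: graph_complex_vertex.
  - by constructor 3.
  - by constructor 1; exact: graph_complex_edge.
have rab : r @: [set a; b]%SET = [set a]%SET.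
  by rewrite imsetU !imset_set1 rb rA // finset.setUid.
apply: (@vertex_retraction R V _ _ r) => //.
- by move=> c cL w wc; exact/rA/(graph_complex_sub EA cL wc).
- move=> c /casesK[cL|->|->].
  + by rewrite rid.
  + by rewrite imset_set1 rb; exact: graph_complex_vertex.
  + by rewrite rab; exact: graph_complex_vertex.
- move=> c /casesK[cL|->|->].
  + by rewrite rid // finset.setUid; apply: simplK; exact: (fintype.subsetP LK).
  + by rewrite imset_set1 rb (finset.setUC [set b]%SET [set a]%SET); exact: (simplK _ abK).
  + rewrite rab (_ : [set a; b] :|: [set a] = [set a; b])%SET; first exact: (simplK _ abK).
    by apply/finset.setUidPl; rewrite finset.sub1set !inE eqxx.
Qed.

(** Connectedness without paths: no proper nonempty set of vertices is closed under adjacency. A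
    proper [B] thus directly yields an edge leaving it, and the property restricts well to the sides
    of a gluing. *)
Definition connected_graph A E := forall B, B \subset A -> B != finset.set0 ->
  (forall e, e \in E -> (e.1 \in B) = (e.2 \in B)) -> B = A.

(** A tree grows by one leaf at a time: connectedness provides an edge leaving [B], and adding it
    preserves contractibility. The case of [k] equal to the number of vertices minus one gives a
    spanning tree. *)
Lemma spanning_tree A E k : A != finset.set0 -> edges_within A E -> connected_graph A E ->
  (k < #|A|)%N -> exists B D, [/\ B \subset A, D \subset E, edges_within B D,
    #|B| = k.+1 /\ #|D| = k & contractible R (realization R (graph_complex B D))].
Proof.
move=> /set0Pn[w wA] EA cG; elim: k => [|k IH] kA.
  exists [set w]%SET, finset.set0; split.
  - by rewrite finset.sub1set.
  - exact: finset.sub0set.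
  - by move=> e; rewrite finset.in_set0.
  - by rewrite cards1 cards0.
  - exact: realization_point.
have [B [D [BA DE DB [cardB cardD] contr]]] := IH (ltnW kA).
have BN0 : B != finset.set0 by rewrite -card_gt0 cardB.
have [e eE eB] : exists2 e, e \in E & (e.1 \in B) != (e.2 \in B).
  apply: contrapT => noe; move: kA; rewrite -(cG _ BA BN0) ?cardB ?ltnn // => e eE.
  by apply/eqP/negPn/negP => eB; apply: noe; exists e.
have [a [b [aB bB bA eab]]] : exists a b, [/\ a \in B, b \notin B, b \in A &
    [set e.1; e.2]%SET = [set a; b]%SET].
  have [e1 e2] := EA _ eE.
  have [e1B|e1B] := boolP (e.1 \in B).
    by exists e.1, e.2; split=> //; move: eB; rewrite e1B.
  exists e.2, e.1; split=> //; last by rewrite finset.setUC.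
  by move: eB; rewrite (negbTE e1B); case: (_ \in B).
have eD : e \notin D.
  by apply/negP => /DB[e1 e2]; move: eB; rewrite e1 e2.
exists (b |: B)%SET, (e |: D)%SET; split.
- by rewrite finset.subUset finset.sub1set bA.
- by rewrite finset.subUset finset.sub1set eE.
- move=> e' /setU1P[->|/DB[e1 e2]]; last by rewrite !inE e1 e2 !orbT.
  have := finset.set21 e.1 e.2; have := finset.set22 e.1 e.2; rewrite eab !inE.
  by move=> /orP[]/eqP-> /orP[]/eqP->; rewrite ?eqxx ?aB ?orbT.
- by rewrite !cardsU1 bB cardB eD cardD.
- exact: homotopy_equivalent_trans (graph_complex_leaf DB aB bB eab) contr.
Qed.

(** Also excludes loops, so each edge has two distinct ends and is determined by them as an
    unordered pair. *)
Definition oriented E := forall e, e \in E -> (e.2, e.1) \notin E.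

Lemma oriented_neq E e : oriented E -> e \in E -> e.1 != e.2.
Proof.
case: e => x y oE eE; apply/eqP => /= xy.
by move: (oE _ eE) (eE); rewrite xy => /= /negbTE ->.
Qed.

Lemma oriented_inj E : oriented E ->
  {in E &, injective (fun e => [set e.1; e.2]%SET)}.
Proof.
move=> oE [x y] [x' y'] eE eE' /= xy.
have /= xyN := oriented_neq oE eE; have /= xyN' := oriented_neq oE eE'.
have := finset.set21 x y; have := finset.set22 x y; rewrite xy !inE.
move=> /orP[]/eqP yE /orP[]/eqP xE; move: eE eE' xyN; rewrite xE yE ?eqxx //.
by move=> eE /oE /=; rewrite eE.
Qed.

Theorem connected_graph_wedge A E n : A != finset.set0 -> edges_within A E ->
    oriented E -> connected_graph A E -> (#|E| + 1 = #|A| + n)%N ->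
  homotopy_equivalent R (realization R (graph_complex A E)) (wedge_of_circles R n).
Proof.
move=> AN0 EA oE cG cardE; have A0 : (0 < #|A|)%N by rewrite card_gt0.
have [|B [D [BA DE DB [cardB cardD] contr]]] := spanning_tree (k := #|A|.-1) AN0 EA cG.
  by rewrite prednK.
have {BA cardB} BA : B = A by apply/eqP; rewrite eqEcard BA cardB prednK //=.
rewrite {}BA in DB contr.
(* The tree has one edge fewer than there are vertices, so exactly [n] edges remain. *)
have nE : n = #|E :\: D|%SET.
  by rewrite finset.cardsD (finset.setIidPr DE) cardD; lia.
rewrite {n cardE}nE.
pose ed (j : 'I_#|E :\: D|%SET) : V * V := enum_val j.
have edP j : ed j \in E /\ ed j \notin D.
  by have := enum_valP j; rewrite inE => /andP[].
have -> : graph_complex A E =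
    attach_edges (graph_complex A D) (fun j => (ed j).1) (fun j => (ed j).2).
  apply/setP => c; rewrite [RHS]inE; apply/idP/orP => [|[]].
  - move=> /graph_complexP[[w wA ->]|[e eE ->]].
      by left; exact: graph_complex_vertex.
    have [eD|eD] := boolP (e \in D); first by left; exact: graph_complex_edge.
    have eED : e \in (E :\: D)%SET by rewrite inE eD.
    right; apply/imsetP; exists (enum_rank_in eED e) => //.
    by rewrite /ed enum_rankK_in.
  - move=> /graph_complexP[[w wA ->]|[e eD ->]]; first exact: graph_complex_vertex.
    by apply: graph_complex_edge; exact: (fintype.subsetP DE).
  - by move=> /imsetP[j _ ->]; apply: graph_complex_edge; case: (edP j).
apply: attach_edges_wedge => //.
- exact: graph_complex_simplicial.
- by move=> j; apply: graph_complex_vertex; case: (EA _ (edP j).1).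
- by move=> j; apply: graph_complex_vertex; case: (EA _ (edP j).1).
- move=> j; have [jE jD] := edP j; apply/graph_complexP => -[[w _ jw]|[e eD je]].
    move/eqP: (oriented_neq oE jE); case.
    have := finset.set21 (ed j).1 (ed j).2; have := finset.set22 (ed j).1 (ed j).2.
    by rewrite jw !inE => /eqP-> /eqP.
  have eE := fintype.subsetP DE _ eD.
  by move: jD; rewrite (oriented_inj oE jE eE je) eD.
- move=> i j /= ij; apply: enum_val_inj.
  exact: (oriented_inj oE (edP i).1 (edP j).1 ij).
Qed.

End Graph.

(** * The graph of extremal elements *)

Section ExtremalGraph.
Context {d : Order.disp_t} (P : finPOrderType d).
Implicit Types (p q m : P) (c : {set P}).

Lemma minimalP p : reflect (forall q, (q <= p)%O -> q = p) (minimal p).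
Proof.
apply: (iffP forallP) => pm q; first by move/implyP: (pm q) => /[apply]/eqP.
by apply/implyP => /pm->.
Qed.

Lemma maximalP p : reflect (forall q, (p <= q)%O -> q = p) (maximal p).
Proof.
apply: (iffP forallP) => pm q; first by move/implyP: (pm q) => /[apply]/eqP.
by apply/implyP => /pm->.
Qed.

Lemma mem_Ext p : (p \in Ext P) = minimal p || maximal p.
Proof. by rewrite /Ext inE. Qed.

Lemma minimal_below p : exists2 m, minimal m & (m <= p)%O.
Proof.
(* Passing to a strictly smaller element loses a member of the down-set, so one of least size
   belongs to a minimal element. *)
pose below q := #|[set q' : P | (q' <= q)%O]%SET|.
have [m mp mmin] := @arg_minnP _ p (fun q => (q <= p)%O) below (lexx p).
exists m => //; apply/minimalP => q qm; apply/eqP/negPn/negP => qNm.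
have /mmin : (q <= p)%O by exact: le_trans mp.
rewrite leqNgt => /negP; apply; apply: proper_card; apply/fintype.properP; split.
  by apply/fintype.subsetP => q'; rewrite !inE => /le_trans; apply.
by exists m; rewrite !inE ?lexx //; apply: contra qNm => mq; rewrite eq_le qm.
Qed.

Lemma maximal_above p : exists2 m, maximal m & (p <= m)%O.
Proof.
pose above q := #|[set q' : P | (q <= q')%O]%SET|.
have [m mp mmin] := @arg_minnP _ p (fun q => (p <= q)%O) above (lexx p).
exists m => //; apply/maximalP => q qm; apply/eqP/negPn/negP => qNm.
have /mmin : (p <= q)%O by exact: le_trans qm.
rewrite leqNgt => /negP; apply; apply: proper_card; apply/fintype.properP; split.
  by apply/fintype.subsetP => q'; rewrite !inE; exact: le_trans.
by exists m; rewrite !inE ?lexx //; apply: contra qNm => mq; rewrite eq_le qm mq.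
Qed.

Lemma mem_Rel p q : ((p, q) \in Rel P) = (p < q)%O.
Proof. by rewrite /Rel inE. Qed.

Definition sole_minimal p m :=
  [/\ minimal m, (m <= p)%O & forall m', minimal m' -> (m' <= p)%O -> m' = m].

Definition sole_maximal p m :=
  [/\ maximal m, (p <= m)%O & forall m', maximal m' -> (p <= m')%O -> m' = m].

(** What a least or greatest element of each piece leaves behind in the glued poset; unlike the
    existence of such an element, it survives gluing. *)
Definition locally_conical := forall p, p \notin Ext P ->
  (exists m, sole_minimal p m) \/ (exists m, sole_maximal p m).

Definition ext_rel : {set P * P} :=
  [set pq in Rel P | (pq.1 \in Ext P) && (pq.2 \in Ext P)]%SET.

Lemma mem_ext_rel p q :
  ((p, q) \in ext_rel) = [&& (p < q)%O, p \in Ext P & q \in Ext P].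
Proof. by rewrite /ext_rel inE /Rel inE. Qed.

Lemma ext_rel_min_max p q : (p, q) \in ext_rel -> minimal p /\ maximal q.
Proof.
rewrite mem_ext_rel !mem_Ext => /and3P[pq pE qE]; have pq' := ltW pq.
case/orP: pE => [pm|/maximalP/(_ _ pq') qp]; last by rewrite qp ltxx in pq.
case/orP: qE => [/minimalP/(_ _ pq') qp|//]; by rewrite qp ltxx in pq.
Qed.

Lemma edges_within_ext_rel : edges_within (Ext P) ext_rel.
Proof. by move=> [p q]; rewrite mem_ext_rel => /and3P[]. Qed.

Lemma oriented_ext_rel : oriented ext_rel.
Proof. by move=> [p q]; rewrite !mem_ext_rel /= => /andP[/lt_gtF-> _]. Qed.

(* m is the image of p under the retraction of P onto its extremal elements. *)
Definition ext_target p m : Prop :=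
  [\/ p \in Ext P /\ m = p,
      p \notin Ext P /\ sole_minimal p m
    | [/\ p \notin Ext P, ~ (exists m', sole_minimal p m') & sole_maximal p m]].

Lemma ext_target_Ext p m : ext_target p m -> m \in Ext P.
Proof.
by rewrite mem_Ext => -[[pE ->]|[_ [->]]|[_ _ [->]]]; rewrite ?orbT // -mem_Ext.
Qed.

(** A sole minimal element is inherited downwards, so [p] and [q] are moved to the same element. An
    extremal [p] is minimal here, as a maximal one would equal [q]. *)
Lemma below_sole_minimal p q m n : (p <= q)%O -> ext_target p m ->
  q \notin Ext P -> sole_minimal q n -> m = n /\ (n <= p)%O.
Proof.
move=> pq pm qE [nmin nq nuniq].
have np : sole_minimal p n.
  have [n' n'min n'p] := minimal_below p.
  have <- := nuniq _ n'min (le_trans n'p pq); split=> // m' m'min m'p.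
  rewrite (nuniq _ m'min (le_trans m'p pq)).
  by rewrite (nuniq _ n'min (le_trans n'p pq)).
have [_ np' nuniqp] := np; split=> //.
case: pm => [[pE ->]|[_ [mmin mp _]]|[_ []]]; last 2 first.
- exact: nuniqp.
- by exists n.
move: (pE); rewrite mem_Ext => /orP[pmin|/maximalP/(_ _ pq) qp].
  exact: nuniqp.
by rewrite qp pE in qE.
Qed.

(** The dual inheritance upwards. It is not a mirror image, because [ext_target] prefers the minimal
    element. *)
Lemma above_sole_maximal p q m n : (p <= q)%O ->
    p \notin Ext P -> ~ (exists m', sole_minimal p m') -> sole_maximal p n ->
  ext_target q m -> m = n /\ (q <= n)%O.
Proof.
move=> pq pE pNmin [nmax pn nuniq].
have nq : sole_maximal q n.
  have [n' n'max n'q] := maximal_above q.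
  have <- := nuniq _ n'max (le_trans pq n'q); split=> // m' m'max m'q.
  rewrite (nuniq _ m'max (le_trans pq m'q)).
  by rewrite (nuniq _ n'max (le_trans pq n'q)).
have [_ qn nuniqq] := nq.
case=> [[qE ->]|[qE qmin]|[_ _ [mmax mq _]]].
- split=> //; move: (qE); rewrite mem_Ext => /orP[/minimalP/(_ _ pq) qp|qmax].
    by rewrite qp qE in pE.
  exact: nuniqq.
(* A sole minimal element below [q] would also be one below [p], which is excluded. *)
- exfalso; apply: pNmin; exists m; have [mmin mq muniq] := qmin.
  have [n' n'min n'p] := minimal_below p.
  have <- := muniq _ n'min (le_trans n'p pq); split=> // m' m'min m'p.
  by rewrite (muniq _ m'min (le_trans m'p pq)) (muniq _ n'min (le_trans n'p pq)).
- by split=> //; exact: nuniqq.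
Qed.

(** This is contiguity of the retraction. Each element either moves outwards, [p] down and [q] up,
    or it moves past the other one, and then both have the same target. *)
Lemma ext_target_comparable p q m n : (p <= q)%O -> ext_target p m -> ext_target q n ->
  [/\ (m >=< n)%O, (p >=< n)%O & (m >=< q)%O].
Proof.
move=> pq pm qn.
have qcase : (q <= n)%O \/ m = n /\ (n <= p)%O.
  case: (qn) => [[_ ->]|[qE qmin]|[_ _ []]]; [by left| |by left].
  by right; exact: below_sole_minimal pm qE qmin.
have pcase : (m <= p)%O \/ m = n /\ (q <= n)%O.
  case: (pm) => [[_ ->]|[_ [_ ? _]]|[pE pNmin pmax]]; [by left|by left|].
  have [nm qm] := above_sole_maximal pq pE pNmin pmax qn.
  by right; rewrite nm.
have le_comp (x y : P) : (x <= y)%O -> (x >=< y)%O by rewrite /Order.comparable => ->.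
have ge_comp (x y : P) : (y <= x)%O -> (x >=< y)%O by rewrite /Order.comparable => ->; rewrite orbT.
case: qcase pcase => [qn'|[mn np]] [mp|[mn' qn'']]; rewrite ?mn ?mn'; split; rewrite ?comparablexx //.
- exact/le_comp/(le_trans mp (le_trans pq qn')).
- exact/le_comp/(le_trans pq qn').
- exact/le_comp/(le_trans mp pq).
- exact/le_comp/(le_trans pq qn').
- exact: ge_comp.
- exact: ge_comp.
- exact/le_comp/(le_trans np pq).
- exact: ge_comp.
- exact: ge_comp.
Qed.

Lemma order_complexP c :
  reflect (c != finset.set0 /\ {in c &, forall p q, (p >=< q)%O})
          (c \in order_complex P).
Proof.
rewrite /order_complex inE; apply: (iffP andP) => -[cN0 cc]; split=> //.
  by move=> p q pc qc; move/forall_inP: cc => /(_ p pc)/forall_inP/(_ q qc).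
by apply/forall_inP => p pc; apply/forall_inP => q; exact: cc.
Qed.

Lemma order_complex_simplicial : simplicial (order_complex P).
Proof.
move=> c /order_complexP[_ cc] c' /fintype.subsetP sc' cN0; apply/order_complexP.
by split=> // p q /sc' pc /sc' qc; exact: cc.
Qed.

(** Two comparable distinct extremal elements are a minimal and a maximal one, which leaves no room
    for a third. *)
Lemma ext_chain c : c \in order_complex P -> c \subset Ext P ->
  c \in graph_complex (Ext P) ext_rel.
Proof.
move=> /order_complexP[/set0Pn[p pc] cc] /fintype.subsetP cE; apply/graph_complexP.
have pairE x y : x \in c -> y \in c -> (x < y)%O -> c = [set x; y]%SET.
  move=> xc yc xy.
  have [xmin ymax] : minimal x /\ maximal y.
    by apply: ext_rel_min_max; rewrite mem_ext_rel xy !cE.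
  apply/setP => z; rewrite !inE; apply/idP/orP => [zc|[]/eqP->//].
  have := cE _ zc; rewrite mem_Ext => /orP[/minimalP zmin|/maximalP zmax].
    have := cc _ _ xc zc; rewrite /Order.comparable => /orP[/zmin->|/(minimalP _ xmin)->]; by left.
  have := cc _ _ yc zc; rewrite /Order.comparable => /orP[/(maximalP _ ymax)->|/zmax->]; by right.
have [[q qc qp]|cp] := pselect (exists2 q, q \in c & q != p); last first.
  left; exists p; first exact: cE.
  apply/setP => q; rewrite inE; apply/idP/eqP => [qc|->//].
  by apply/eqP/negPn/negP => qp; apply: cp; exists q.
right; have := cc _ _ pc qc; rewrite /Order.comparable => /orP[pq|qp'].
  have pq' : (p < q)%O by rewrite lt_neqAle eq_sym qp.
  by exists (p, q); [rewrite mem_ext_rel pq' !cE|exact: pairE].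
have qp'' : (q < p)%O by rewrite lt_neqAle qp.
by exists (q, p); [rewrite mem_ext_rel qp'' !cE|exact: pairE].
Qed.

Lemma order_complex_ext_graph (R : realType) : locally_conical ->
  homotopy_equivalent R (realization R (order_complex P))
    (realization R (graph_complex (Ext P) ext_rel)).
Proof.
move=> con.
have /choice[r rP] : forall p, exists m, ext_target p m.
  move=> p; have [pE|pE] := boolP (p \in Ext P); first by exists p; constructor 1.
  have [[m pm]|pNm] := pselect (exists m, sole_minimal p m).
    by exists m; constructor 2.
  by have [//|[m pm]] := con _ pE; exists m; constructor 3.
have rE p : p \in Ext P -> r p = p.
  by move=> pE; case: (rP p) => [[]//|[]|[]]; rewrite pE.
have rcomp p q : (p >=< q)%O -> [/\ (r p >=< r q)%O, (p >=< r q)%O & (r p >=< q)%O].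
  rewrite {1}/Order.comparable => /orP[/ext_target_comparable|/ext_target_comparable] H.
    exact: H.
  have [] := H _ _ (rP q) (rP p).
  by rewrite comparable_sym => ? ? ?; split=> //; rewrite comparable_sym.
have chain c : c \in order_complex P -> c :|: r @: c \in order_complex P.
  move=> /order_complexP[/set0Pn[p pc] cc]; apply/order_complexP; split.
    by apply/set0Pn; exists p; rewrite inE pc.
  move=> x y /setUP[xc|/imsetP[x' xc ->]] /setUP[yc|/imsetP[y' yc ->]].
  - exact: cc.
  - by case: (rcomp _ _ (cc _ _ xc yc)).
  - by case: (rcomp _ _ (cc _ _ xc yc)).
  - by case: (rcomp _ _ (cc _ _ xc yc)).
apply: (@vertex_retraction R P _ _ r).
- apply/fintype.subsetP => c /graph_complexP[[p pE ->]|[[p q] pq ->]] /=; apply/order_complexP; split.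
  + by apply/set0Pn; exists p; rewrite inE.
  + by move=> x y; rewrite !inE => /eqP-> /eqP->; rewrite comparablexx.
  + by apply/set0Pn; exists p; rewrite !inE eqxx.
  + move: pq; rewrite mem_ext_rel => /andP[pq _].
    have pq' : (p >=< q)%O by rewrite /Order.comparable ltW.
    by move=> x y; rewrite !inE => /orP[]/eqP-> /orP[]/eqP->; rewrite ?comparablexx // comparable_sym.
- move=> c cL p pc; apply: rE; exact: graph_complex_sub edges_within_ext_rel cL pc.
- move=> c cK; apply: ext_chain.
    apply: (order_complex_simplicial (chain _ cK)); first exact: finset.subsetUr.
    have /order_complexP[/set0Pn[p pc] _] := cK.
    by apply/set0Pn; exists (r p); exact: imset_f.
  by apply/fintype.subsetP => _ /imsetP[p _ ->]; exact: ext_target_Ext (rP p).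
- by move=> c /chain; exact: order_complex_simplicial.
Qed.

Definition ext_connected := connected_graph (Ext P) ext_rel.

Theorem order_complex_wedge (R : realType) n : Ext P != finset.set0 ->
    locally_conical -> ext_connected -> (#|ext_rel| + 1 = #|Ext P| + n)%N ->
  homotopy_equivalent R (realization R (order_complex P)) (wedge_of_circles R n).
Proof.
move=> EN0 con cG cardE.
apply: homotopy_equivalent_trans (order_complex_ext_graph R con) _.
exact: connected_graph_wedge edges_within_ext_rel oriented_ext_rel cG cardE.
Qed.

End ExtremalGraph.

(** * Index *)

Local Close Scope classical_set_scope.

(** * The kernel of the form and isotropic subspaces *)

Section FormKernel.
Variables (k : fieldType) (n : nat) (F : 'Hom('M[k]_n, k^o)).
Implicit Types (L U C A : {vspace 'M[k]_n}) (x y : 'M[k]_n).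

Lemma lie_bracketC x y : lie_bracket x y = - lie_bracket y x.
Proof. by rewrite /lie_bracket opprB. Qed.

Lemma lie_bracketDl x y z : lie_bracket (x + y) z = lie_bracket x z + lie_bracket y z.
Proof. by rewrite /lie_bracket mulmxDl mulmxDr opprD addrACA. Qed.

Lemma lie_bracketDr x y z : lie_bracket z (x + y) = lie_bracket z x + lie_bracket z y.
Proof. by rewrite /lie_bracket mulmxDl mulmxDr opprD addrACA. Qed.

Lemma dimv_pairing_le U C :
    (forall x, x \in U -> (forall c, c \in C -> F (lie_bracket x c) = 0) -> x = 0) ->
  (\dim U <= \dim C)%N.
Proof.
move=> nondeg.
pose phi x : 'rV[k]_(\dim C) := \row_i lie_form F (vbasis C)`_i x.
have phi_lin : linear phi.
  by move=> a x y; apply/rowP => i; rewrite !mxE linearP.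
pose phiL : {linear 'M[k]_n -> 'rV[k]_(\dim C)} :=
  HB.pack phi (GRing.isLinear.Build _ _ _ _ phi phi_lin).
have ker0 : (U :&: lker (linfun phiL) = 0)%VS.
  apply/eqP; rewrite -subv0; apply/subvP => x /memv_capP[xU].
  rewrite memv_ker lfunE /= => /eqP xker; rewrite memv0; apply/eqP/nondeg => // c.
  move=> /coord_vbasis ->; rewrite /lie_bracket mulmx_sumr mulmx_suml -sumrB.
  rewrite linear_sum big1 // => i _.
  rewrite -scalemxAr -scalemxAl -scalerBr linearZ /=.
  by have := congr1 (fun r : 'rV_ _ => r 0 i) xker; rewrite !mxE /lie_form => ->; rewrite scaler0.
rewrite -(limg_dim_eq ker0); apply: leq_trans (dimvS (subvf _)) _.
by rewrite dimvf dim_matrix; lia.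
Qed.

Definition isotropic A := forall x y, x \in A -> y \in A -> F (lie_bracket x y) = 0.

(** As [A] is isotropic, an element of [A] outside the kernel is detected by a complement of [A] in
    [L]. Hence a complement of the kernel within [A] has dimension at most dim L - dim A. *)
Lemma ker_form_ge L A : (A <= L)%VS -> isotropic A ->
  (2 * \dim A <= \dim L + \dim (ker_form L F))%N.
Proof.
move=> AL Aiso; set K := ker_form L F.
have le_dim : (\dim (A :\: K) <= \dim (L :\: A))%N.
  apply: dimv_pairing_le => x xAK xC.
  have xA : x \in A by exact: subvP (diffvSl _ _) _ xAK.
  have xK : x \in K.
    apply/mem_ker_form; split; first exact: subvP AL _ xA.
    move=> y; rewrite -{1}(addv_diff_cap L A) => /memv_addP[c cC [a aA ->]].
    move: aA; rewrite memv_cap => /andP[_ aA].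
    by rewrite lie_bracketDr linearD /= xC // Aiso // addr0.
  have : x \in ((A :\: K) :&: K)%VS by rewrite memv_cap xAK.
  by rewrite capv_diff memv0 => /eqP.
have := dimv_cap_compl A K; have := dimv_cap_compl L A.
have := dimvS (capvSr A K); rewrite (capv_idPr AL).
lia.
Qed.

(** The hypotheses force the kernel into [A]; then [U] pairs faithfully with a complement of the
    kernel in [A]. *)
Lemma ker_form_le L U A : L = (U + A)%VS -> isotropic U -> isotropic A ->
    (U :&: ker_form L F = 0)%VS ->
  (\dim (ker_form L F) + \dim U <= \dim A)%N.
Proof.
move=> LUA Uiso Aiso UK0; set K := ker_form L F.
have K0 x : x \in U -> x \in K -> x = 0.
  by move=> xU xK; apply/eqP; rewrite -memv0 -UK0 memv_cap xU.
have UL : (U <= L)%VS by rewrite LUA addvSl.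
have AL : (A <= L)%VS by rewrite LUA addvSr.
have KA : (K <= A)%VS.
  apply/subvP => x xK; have /mem_ker_form[xL xker] := xK.
  (* The component [u] of a kernel vector pairs to zero with [U] by isotropy, and with [A] because
     [x] and [a] do. So [u] is in the kernel itself. *)
  move: xL; rewrite LUA => /memv_addP[u uU [a aA xE]].
  suff u0 : u = 0 by rewrite xE u0 add0r.
  apply: K0 => //; apply/mem_ker_form; split; first exact: subvP UL _ uU.
  move=> y; rewrite LUA => /memv_addP[u' u'U [a' a'A ->]].
  rewrite lie_bracketDr linearD /= Uiso // add0r.
  have -> : F (lie_bracket u a') = F (lie_bracket x a').
    by rewrite [in RHS]xE lie_bracketDl [RHS]linearD /= (Aiso a) // addr0.
  by apply: xker; exact: subvP AL _ a'A.
have le_dim : (\dim U <= \dim (A :\: K))%N.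
  apply: dimv_pairing_le => x xU xC; apply: K0 => //.
  apply/mem_ker_form; split; first exact: subvP UL _ xU.
  move=> y; rewrite LUA => /memv_addP[u uU [a aA ->]].
  rewrite lie_bracketDr linearD /= Uiso // add0r.
  move: aA; rewrite -{1}(addv_diff_cap A K) => /memv_addP[c cC [b bK ->]].
  rewrite lie_bracketDr linearD /= xC // add0r.
  move: bK; rewrite memv_cap => /andP[_ /mem_ker_form[_ bker]].
  by rewrite lie_bracketC linearN /= bker ?oppr0 //; exact: subvP UL _ xU.
have := dimv_cap_compl A K; rewrite (capv_idPr KA).
lia.
Qed.

Lemma lie_index_ge L m : (forall F', m <= \dim (ker_form L F'))%N ->
  (m <= lie_index L)%N.
Proof.
move=> mle; rewrite /lie_index; case: ex_minnP => i /asboolP[F' <-] _.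
exact: mle.
Qed.

Lemma lie_index_le L : (lie_index L <= \dim (ker_form L F))%N.
Proof.
rewrite /lie_index; case: ex_minnP => i _; apply.
by apply/asboolP; exists F.
Qed.

End FormKernel.

(** * Matrices indexed by a poset, in coordinates *)

Section PosetMatrices.
Context (k : fieldType) {d : Order.disp_t} (P : finPOrderType d).
Implicit Types (p q u v : P) (B : 'M[k]_#|P|) (X : {pred P * P}).

Definition mat (b : P -> P -> k) : 'M[k]_#|P| :=
  \matrix_(i, j) b (enum_val i) (enum_val j).

Lemma coeff_mat b p q : poset_coeff (mat b) p q = b p q.
Proof. by rewrite /poset_coeff mxE !enum_rankK. Qed.

Lemma coeff_inj B B' :
  (forall p q, poset_coeff B p q = poset_coeff B' p q) -> B = B'.
Proof.
move=> BB; apply/matrixP => i j; have := BB (enum_val i) (enum_val j).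
by rewrite /poset_coeff !enum_valK.
Qed.

Lemma coeff_functional p q B : poset_functional k [set (p, q)] B = poset_coeff B p q.
Proof. by rewrite lfunE /= /sum_coeff big_set1. Qed.

Lemma coeff_E u v p q :
  poset_coeff (poset_E k u v) p q = ((p == u) && (q == v))%:R.
Proof. by rewrite /poset_coeff mxE !(inj_eq enum_rank_inj). Qed.

Lemma coeffD B B' p q : poset_coeff (B + B') p q = poset_coeff B p q + poset_coeff B' p q.
Proof. by rewrite /poset_coeff mxE. Qed.

Lemma coeffB B B' p q : poset_coeff (B - B') p q = poset_coeff B p q - poset_coeff B' p q.
Proof. by rewrite /poset_coeff !mxE. Qed.

Lemma coeffM B B' p q :
  poset_coeff (B *m B') p q = \sum_r poset_coeff B p r * poset_coeff B' r q.
Proof.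
rewrite /poset_coeff mxE (reindex (@enum_rank P)) //.
by exists enum_val => x _; rewrite ?enum_rankK ?enum_valK.
Qed.

Lemma coeff_tr B : \tr B = \sum_p poset_coeff B p p.
Proof.
rewrite /mxtrace (reindex (@enum_rank P)) //.
by exists enum_val => x _; rewrite ?enum_rankK ?enum_valK.
Qed.

Definition unit_span X : {vspace 'M[k]_#|P|} :=
  <<[seq poset_E k pq.1 pq.2 | pq <- enum X]>>%VS.

Lemma span_units_coeff (s : seq (P * P)) B p q :
  B \in <<[seq poset_E k pq.1 pq.2 | pq <- s]>>%VS -> (p, q) \notin s ->
  poset_coeff B p q = 0.
Proof.
move=> Bs pqs; suff : B \in lker (poset_functional k [set (p, q)]).
  by rewrite memv_ker coeff_functional => /eqP.
apply: subvP Bs; apply/span_subvP => _ /mapP[[u v] uvs ->].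
rewrite memv_ker coeff_functional coeff_E -xpair_eqE /=.
by have [pq|_] := (p, q) =P (u, v); [rewrite pq uvs in pqs|exact: eqxx].
Qed.

Lemma sum_units B :
  B = \sum_(pq : P * P) poset_coeff B pq.1 pq.2 *: poset_E k pq.1 pq.2.
Proof.
apply: coeff_inj => p q.
rewrite -[RHS]coeff_functional linear_sum /=.
rewrite (eq_bigr (fun pq => poset_coeff B pq.1 pq.2 * ((p, q) == pq)%:R)); last first.
  by move=> [u v] _; rewrite linearZ /= coeff_functional coeff_E xpair_eqE.
rewrite (bigD1 (p, q)) //= eqxx mulr1 big1 ?addr0 // => uv.
by rewrite eq_sym => /negbTE->; rewrite mulr0.
Qed.

Lemma mem_unit_span X B :
  B \in unit_span X <-> forall p q, (p, q) \notin X -> poset_coeff B p q = 0.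
Proof.
split=> [BX p q pqX|BX].
  by apply: span_units_coeff BX _; rewrite mem_enum.
rewrite [B]sum_units; apply: memv_suml => -[p q] _ /=.
have [pqX|/BX->] := boolP ((p, q) \in X); last by rewrite scale0r mem0v.
apply/memvZ/memv_span/mapP; exists (p, q) => //.
by rewrite mem_enum.
Qed.

Lemma dim_unit_span X : \dim (unit_span X) = #|X|.
Proof.
suff fr (s : seq (P * P)) : uniq s -> free [seq poset_E k pq.1 pq.2 | pq <- s].
  by have /eqP := fr _ (enum_uniq X); rewrite /unit_span => ->; rewrite size_map cardE.
elim: s => [_|[p q] s IH /= /andP[pqs us]]; first by rewrite nil_free.
rewrite free_cons IH // andbT; apply/negP => /span_units_coeff/(_ pqs)/eqP.
by rewrite coeff_E !eqxx oner_eq0.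
Qed.

Lemma lie_posetE : lie_poset k P = unit_span [pred pq : P * P | (pq.1 <= pq.2)%O].
Proof. by []. Qed.

Lemma mem_lie_poset B :
  B \in lie_poset k P <-> forall p q, ~~ (p <= q)%O -> poset_coeff B p q = 0.
Proof. exact: mem_unit_span. Qed.

Lemma mem_lie_posetA B :
  B \in lie_posetA k P <-> B \in lie_poset k P /\ \sum_p poset_coeff B p p = 0.
Proof.
rewrite memv_cap memv_ker lfunE /= /mxtr coeff_tr.
by split=> [/andP[-> /eqP]|[-> ->]] //=.
Qed.

(** The diagonal unit at [p0] has trace 1, so the trace condition costs exactly one dimension. *)
Lemma dim_lie_posetA (p0 : P) : (\dim (lie_posetA k P) + 1 = #|P| + #|Rel P|)%N.
Proof.
have <- : \dim (lie_poset k P) = (#|P| + #|Rel P|)%N.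
  rewrite lie_posetE dim_unit_span.
  have -> : #|P| = #|[set (p, p) | p : P]|.
    by rewrite card_imset // => p q [].
  rewrite -cardsUI (_ : _ :&: _ = finset.set0) ?cards0 ?addn0.
    apply: eq_card => -[p q]; rewrite !inE /= le_eqVlt; congr (_ || _).
    apply/eqP/imsetP => [->|[r _ [-> ->//]]]; by exists q.
  apply/setP => -[p q]; rewrite !inE /=; apply/negP => /andP[/imsetP[r _ [-> ->]]].
  by rewrite ltxx.
rewrite -(limg_ker_dim (linfun (@mxtr k _ P)) (lie_poset k P)); congr (_ + _)%N.
apply/esym/eqP; rewrite eqn_leq; apply/andP; split.
  by apply: leq_trans (dimvS (subvf _)) _; rewrite dimvf.
have <- : \dim <[1 : k^o]>%VS = 1%N by rewrite dim_vline oner_eq0.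
apply: dimvS; rewrite -memvE.
have <- : linfun (@mxtr k _ P) (poset_E k p0 p0) = 1.
  rewrite lfunE /= /mxtr coeff_tr (bigD1 p0) //= coeff_E eqxx big1 ?addr0 // => p.
  by rewrite coeff_E => /negbTE->.
apply: memv_img; apply/mem_lie_poset => p q pq; rewrite coeff_E.
by case: eqP => // pE; case: eqP => // qE; rewrite pE qE lexx in pq.
Qed.

(** Turns membership in the kernel into linear equations between entries, the form in which [rigid]
    states them. *)
Lemma functional_bracket_E (T : {set P * P}) p q B :
  poset_functional k T (lie_bracket (poset_E k p q) B) =
  \sum_(v | (p, v) \in T) poset_coeff B q v - \sum_(u | (u, q) \in T) poset_coeff B u p.
Proof.
rewrite lfunE /= /sum_coeff /lie_bracket.
rewrite (eq_bigr (fun uv : P * P =>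
  \sum_r poset_coeff (poset_E k p q) uv.1 r * poset_coeff B r uv.2 -
  \sum_r poset_coeff B uv.1 r * poset_coeff (poset_E k p q) r uv.2)); last first.
  by move=> uv _; rewrite -!coeffM -coeffB.
rewrite sumrB; congr (_ - _).
- rewrite (eq_bigr (fun uv => (uv.1 == p)%:R * poset_coeff B q uv.2)); last first.
    move=> [u v] _ /=; rewrite (bigD1 q) //= coeff_E eqxx andbT big1 ?addr0 // => r rq.
    by rewrite coeff_E (negbTE rq) andbF mul0r.
  rewrite (bigID (fun uv => uv.1 == p)) /= [X in _ + X]big1 ?addr0; last first.
    by move=> uv /andP[_ /negbTE->]; rewrite mul0r.
  rewrite (reindex_onto (fun v => (p, v)) snd) /=; last by move=> [u v] /andP[_ /eqP/= ->].
  by apply: eq_big => [v|v _]; rewrite ?eqxx ?andbT ?mul1r.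
- rewrite (eq_bigr (fun uv => (uv.2 == q)%:R * poset_coeff B uv.1 p)); last first.
    move=> [u v] _ /=; rewrite (bigD1 p) //= coeff_E eqxx mulrC big1 ?addr0 // => r rp.
    by rewrite coeff_E (negbTE rp) mulr0.
  rewrite (bigID (fun uv => uv.2 == q)) /= [X in _ + X]big1 ?addr0; last first.
    by move=> uv /andP[_ /negbTE->]; rewrite mul0r.
  rewrite (reindex_onto (fun u => (u, q)) fst) /=; last by move=> [u v] /andP[_ /eqP/= ->].
  by apply: eq_big => [v|v _]; rewrite ?eqxx ?andbT ?mul1r.
Qed.

End PosetMatrices.

(** * The two isotropic parts of the trace zero algebra *)

Section Index.
Context (k : fieldType) {d : Order.disp_t} (P : finPOrderType d).
Variables N T : {set P * P}.
Implicit Types (p q r u v : P) (B : 'M[k]_#|P|).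

(** The equations say that [b] is orthogonal to the units [E_{p,q}] with [(p, q)] in [N]; the
    conclusion is that [b] is scalar. A function [b] is used instead of a matrix so that it can be
    restricted along an embedding of posets. *)
Definition rigid := forall b : P -> P -> k,
  (forall p q, b p q != 0 -> p = q \/ (p < q)%O /\ (p, q) \notin N) ->
  (forall p q, (p, q) \in N ->
     \sum_(v | (p, v) \in T) b q v = \sum_(u | (u, q) \in T) b u p) ->
  exists a, forall p q, b p q = a *+ (p == q).

Hypothesis NRel : N \subset Rel P.
(** Two matrices supported on [N] have product zero. By [N_split], a product of two matrices
    supported off [N], diagonal included, has no entry in [N], so a functional supported on [T] does
    not see it. *)
Hypothesis N_abelian : forall p q r, (p, q) \in N -> (q, r) \notin N.
Hypothesis N_split : forall p q r, (p < q)%O -> (q < r)%O -> (p, r) \in N ->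
  (p, q) \in N \/ (q, r) \in N.
Hypothesis TN : T \subset N.

Local Notation gA := (lie_posetA k P).
Local Notation F_T := (poset_functional k T).

Definition weak_pairs : pred (P * P) := [pred pq | (pq.1 <= pq.2)%O && (pq \notin N)].

Definition upper_part : {vspace 'M[k]_#|P|} := unit_span k (mem N).

Definition lower_part : {vspace 'M[k]_#|P|} :=
  (unit_span k weak_pairs :&: lker (linfun (@mxtr k _ P)))%VS.

Let N_lt p q : (p, q) \in N -> (p < q)%O.
Proof. by move=> /(fintype.subsetP NRel); rewrite inE. Qed.

Lemma lower_part_coeff B p q : B \in lower_part -> poset_coeff B p q != 0 ->
  p = q \/ (p < q)%O /\ (p, q) \notin N.
Proof.
rewrite memv_cap => /andP[/mem_unit_span BX _] Bpq.
have : (p, q) \in weak_pairs.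
  by apply: contraR Bpq => /BX ->.
by rewrite inE /= le_eqVlt => /andP[/orP[/eqP->|pq] pqN]; [left|right].
Qed.

Lemma lie_posetA_parts : gA = (lower_part + upper_part)%VS.
Proof.
apply/eqP; rewrite eqEsubv; apply/andP; split; apply/subvP => B.
  move=> /mem_lie_posetA[/mem_lie_poset BP trB].
  pose b0 p q := if (p, q) \in N then 0 else poset_coeff B p q.
  pose b1 p q := if (p, q) \in N then poset_coeff B p q else 0.
  apply/memv_addP; exists (mat b0); [|exists (mat b1)].
  - rewrite memv_cap memv_ker lfunE /= /mxtr coeff_tr; apply/andP; split.
      apply/mem_unit_span => p q; rewrite inE /= coeff_mat /b0.
      by case: ifP => //= _; rewrite andbT; exact: BP.
    apply/eqP; rewrite -[RHS]trB; apply: eq_bigr => p _; rewrite coeff_mat /b0.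
    by case: ifP => // /N_lt; rewrite ltxx.
  - apply/mem_unit_span => p q pqN; rewrite coeff_mat /b1.
    by case: ifP => // pqN'; move: pqN; rewrite /= -[_ \in mem N]/(_ \in N) pqN'.
  - apply: coeff_inj => p q; rewrite coeffD !coeff_mat /b0 /b1.
    by case: ifP; rewrite ?add0r ?addr0.
move=> /memv_addP[B0 B0P [B1 /mem_unit_span B1P ->]].
move: B0P; rewrite memv_cap memv_ker lfunE /= /mxtr coeff_tr => /andP[/mem_unit_span B0P /eqP tr0].
apply/mem_lie_posetA; split.
  apply/mem_lie_poset => p q pq; rewrite coeffD B0P ?B1P ?addr0 //.
    by apply/negP => /N_lt /ltW pq'; rewrite pq' in pq.
  by rewrite inE /= (negbTE pq).
rewrite -[RHS]tr0; apply: eq_bigr => p _; rewrite coeffD B1P ?addr0 //.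
by apply/negP => /N_lt; rewrite ltxx.
Qed.

Lemma parts_disjoint : (lower_part :&: upper_part = 0)%VS.
Proof.
apply/eqP; rewrite -subv0; apply/subvP => B.
rewrite memv_cap => /andP[B0 /mem_unit_span B1]; rewrite memv0; apply/eqP/coeff_inj => p q.
rewrite [RHS]mxE; apply/eqP/negPn/negP => Bpq.
have pqN : (p, q) \in N by apply: contraR Bpq => /B1 ->.
case: (lower_part_coeff B0 Bpq) => [pq|[_]]; last by rewrite pqN.
by move: (N_lt pqN); rewrite pq ltxx.
Qed.

Lemma dim_upper_part : \dim upper_part = #|N|.
Proof. exact: dim_unit_span. Qed.

Lemma upper_part_isotropic F : isotropic F upper_part.
Proof.
have mul0 x y : x \in upper_part -> y \in upper_part -> x *m y = 0.
  move=> /mem_unit_span xN /mem_unit_span yN; apply: coeff_inj => p q.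
  rewrite coeffM [RHS]mxE big1 // => r _.
  have [prN|prN] := boolP ((p, r) \in N); last by rewrite xN ?mul0r.
  by rewrite yN ?mulr0 //; exact: N_abelian prN.
by move=> x y xU yU; rewrite /lie_bracket !mul0 // subr0 linear0.
Qed.

Lemma lower_part_isotropic : isotropic F_T lower_part.
Proof.
have mul0 x y p q : x \in lower_part -> y \in lower_part -> (p, q) \in N ->
    poset_coeff (x *m y) p q = 0.
  move=> xL yL pqN; rewrite coeffM big1 // => r _.
  apply/eqP; rewrite mulf_eq0 -implyNb; apply/implyP => /(lower_part_coeff xL) pr.
  apply/negPn/negP => /(lower_part_coeff yL) rq.
  case: pr rq => [pr|[pr prN]] [rqE|[rq rqN]].
  - by move: (N_lt pqN); rewrite pr rqE ltxx.
  - by rewrite -pr pqN in rqN.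
  - by rewrite rqE pqN in prN.
  - by case: (N_split pr rq pqN) => H; [rewrite H in prN|rewrite H in rqN].
move=> x y xL yL; rewrite lfunE /= /sum_coeff big1 // => -[p q] /(fintype.subsetP TN) pqN.
by rewrite /lie_bracket coeffB !mul0 ?subr0.
Qed.

Lemma dim_ker_ge F : (2 * #|N| <= \dim gA + \dim (ker_form gA F))%N.
Proof.
rewrite -dim_upper_part; apply: ker_form_ge; last exact: upper_part_isotropic.
by rewrite lie_posetA_parts addvSr.
Qed.

(** The lower part has dimension dim g_A(P) - |N|, and the kernel together with it fits into the |N|
    dimensions of the upper part. *)
Lemma dim_ker_le : (lower_part :&: ker_form gA F_T = 0)%VS ->
  (\dim (ker_form gA F_T) + \dim gA <= 2 * #|N|)%N.
Proof.
move=> K0.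
have := ker_form_le lie_posetA_parts lower_part_isotropic (@upper_part_isotropic _) K0.
have := dimv_disjoint_sum parts_disjoint; rewrite -lie_posetA_parts dim_upper_part.
lia.
Qed.

(** Testing against the units in [N] makes a kernel element of the lower part scalar by [rigid].
    Trace zero then gives |P| a = 0, and characteristic zero gives a = 0. *)
Lemma lower_part_ker0 (p0 : P) : [pchar k] =i pred0 -> rigid ->
  (lower_part :&: ker_form gA F_T = 0)%VS.
Proof.
move=> chark rig; apply/eqP; rewrite -subv0; apply/subvP => B.
rewrite memv_cap => /andP[BL /mem_ker_form[/mem_lie_posetA[_ trB] BK]].
have [||a Ba] := rig (poset_coeff B).
- by move=> p q; exact: lower_part_coeff.
- move=> p q pqN; apply/eqP; rewrite -subr_eq0 -functional_bracket_E.
  rewrite lie_bracketC linearN /= BK ?oppr0 //.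
  rewrite lie_posetA_parts; apply: subvP (addvSr _ _) _ _.
  apply/mem_unit_span => u v uvN; rewrite coeff_E.
  have [uE|_] := u =P p; last by [].
  have [vE|_] := v =P q; last by [].
  by move: uvN; rewrite uE vE -[_ \in mem N]/(_ \in N) pqN.
- have a0 : a = 0.
    move: trB; rewrite (eq_bigr (fun=> a)); last by move=> p _; rewrite Ba eqxx.
    rewrite sumr_const -mulr_natr => /eqP; rewrite mulf_eq0 => /orP[/eqP//|].
    rewrite ((pcharf0P k).1 chark) => P0.
    have : p0 \in P by [].
    by move/card0_eq/(_ p0): (eqP P0) => ->.
  by rewrite memv0; apply/eqP/coeff_inj => p q; rewrite Ba a0 mul0rn [RHS]mxE.
Qed.

End Index.

(* The invariant of the construction: T is the edge set of the graph of a small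
   functional F, N consists of the relations from sources to sinks of the
   pieces, and [data_rigid] is (F4) for matrices supported off N. *)
Record toral_data (k : fieldType) (d : Order.disp_t) (P : finPOrderType d)
    (N T : {set P * P}) : Prop := ToralData {
  data_Rel : N \subset Rel P;
  data_abelian : forall p q r, (p, q) \in N -> (q, r) \notin N;
  data_split : forall p q r, (p < q)%O -> (q < r)%O -> (p, r) \in N ->
    (p, q) \in N \/ (q, r) \in N;
  data_sub : T \subset N;
  data_rigid : rigid k N T;
  data_ext : ext_rel P \subset T;
  data_card : #|N :\: ext_rel P| = (#|Rel P :\: N| + #|~: Ext P|)%N;
  data_conical : locally_conical P;
  data_connected : ext_connected P;
  data_noiso : forall p : P, ~~ (minimal p && maximal p);
  data_inhabited : Ext P != finset.set0
}.

(** Both bounds give the index 2|N| - dim g_A(P), and [data_card] is the additive form of |N| - |Rel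
    P \ N| - |P| + 1 = |ext_rel P| - |Ext P| + 1. *)
Lemma toral_data_index (k : fieldType) (d : Order.disp_t) (P : finPOrderType d)
    (N T : {set P * P}) : [pchar k] =i pred0 -> toral_data k N T ->
  (#|ext_rel P| + 1 = #|Ext P| + lie_index (lie_posetA k P))%N.
Proof.
move=> chark [NRel Nab Nsplit TN rig extT cardN _ _ _ /set0Pn[p0 _]].
have K0 := lower_part_ker0 NRel p0 chark rig.
have ge : (2 * #|N| - \dim (lie_posetA k P) <= lie_index (lie_posetA k P))%N.
  by apply: lie_index_ge => F; rewrite leq_subLR; exact: dim_ker_ge.
have le := lie_index_le (poset_functional k T) (lie_posetA k P).
have le' := dim_ker_le NRel Nab Nsplit TN K0.
have dimA := dim_lie_posetA k p0.
have cP : (#|Ext P| + #|~: Ext P| = #|P|)%N by exact: cardsC.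
have cR : (#|Rel P :\: N| = #|Rel P| - #|N|)%N.
  by rewrite cardsD (finset.setIidPr NRel).
have extN := fintype.subset_trans extT TN.
have cN : (#|N :\: ext_rel P| = #|N| - #|ext_rel P|)%N.
  by rewrite cardsD (finset.setIidPr extN).
have := subset_leq_card NRel; have := subset_leq_card extN.
move: ge le le' dimA cP cR cN cardN.
move: (\dim _) (\dim _) (lie_index _) #|Rel P :\: N| #|N :\: ext_rel P| #|N|.
move: #|ext_rel P| #|Rel P| #|~: Ext P| #|Ext P| #|P|.
lia.
Qed.

(** With kernel zero the two bounds meet, so both isotropic parts have half the dimension of
    g_A(P). *)
Lemma frobenius_card (k : fieldType) (d : Order.disp_t) (P : finPOrderType d)
    (N T : {set P * P}) (p0 : P) : N \subset Rel P ->
    (forall p q r, (p, q) \in N -> (q, r) \notin N) ->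
    (forall p q r, (p < q)%O -> (q < r)%O -> (p, r) \in N ->
      (p, q) \in N \/ (q, r) \in N) ->
    T \subset N -> frobenius_functional (lie_posetA k P) (poset_functional k T) ->
  (#|P| + #|Rel P| = 2 * #|N| + 1)%N.
Proof.
move=> NRel Nab Nsplit TN frob; have /eqP := frob; rewrite dimv_eq0 => /eqP K0.
have := dim_ker_ge NRel Nab (poset_functional k T).
have := @dim_ker_le k _ _ _ _ NRel Nab Nsplit TN; rewrite K0 capv0 dimv0 => /(_ erefl).
have := dim_lie_posetA k p0.
lia.
Qed.

(** * Gluing *)

(** A symmetric form of [glued]: it records that some pair is identified and that identified pairs
    match. Each lemma about the side of [S] then serves [Q] through [amalgam_sym]. *)
Definition amalgam (dS dQ dP : Order.disp_t) (S : finPOrderType dS)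
    (Q : finPOrderType dQ) (P : finPOrderType dP) (f : S -> P) (g : Q -> P) : Prop :=
  [/\ injective f /\ injective g,
      forall p, (exists s, f s = p) \/ (exists q, g q = p),
      forall p p' : P, (p <= p')%O <->
        (exists s s', [/\ f s = p, f s' = p' & (s <= s')%O]) \/
        (exists q q', [/\ g q = p, g q' = p' & (q <= q')%O]),
      forall s q, f s = g q ->
        (minimal s && minimal q) || (maximal s && maximal q)
    & exists s q, f s = g q].

Lemma amalgam_sym (dS dQ dP : Order.disp_t) (S : finPOrderType dS)
    (Q : finPOrderType dQ) (P : finPOrderType dP) (f : S -> P) (g : Q -> P) :
  amalgam f g -> amalgam g f.
Proof.
move=> [[finj ginj] cov ord mat [s [q sq]]]; split=> //.
- by move=> p; case: (cov p); [right|left].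
- by move=> p p'; rewrite ord; split=> -[]; by [right|left].
- by move=> q' s' /esym/mat /orP[]/andP[-> ->]; rewrite ?orbT.
- by exists q, s.
Qed.

Definition push_pairs (S P : finType) (f : S -> P) (X : {set S * S}) : {set P * P} :=
  [set (f x.1, f x.2) | x in X].

Definition glue_pairs (S Q P : finType) (f : S -> P) (g : Q -> P)
    (X : {set S * S}) (Y : {set Q * Q}) : {set P * P} :=
  push_pairs f X :|: push_pairs g Y.

Lemma glue_pairsC (S Q P : finType) (f : S -> P) (g : Q -> P) X Y :
  glue_pairs f g X Y = glue_pairs g f Y X.
Proof. exact: finset.setUC. Qed.

Section Amalgam.
Context {dS dQ dP : Order.disp_t} (S : finPOrderType dS)
  (Q : finPOrderType dQ) (P : finPOrderType dP) (f : S -> P) (g : Q -> P).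
Hypothesis am : amalgam f g.
Hypothesis noisoS : forall s : S, ~~ (minimal s && maximal s).
Implicit Types (s : S) (q : Q) (p : P).

Lemma amalgam_inj : injective f.
Proof. by case: am => -[]. Qed.

Lemma amalgam_cover p : (exists s, p = f s) \/ (exists q, p = g q).
Proof. by case: am => _ cov _ _ _; case: (cov p) => -[x <-]; [left|right]; exists x. Qed.

Lemma amalgam_le s s' : (s <= s')%O -> (f s <= f s')%O.
Proof. by move=> ss'; case: am => _ _ ord _ _; apply/ord; left; exists s, s'. Qed.

Lemma amalgam_lt s s' : (s < s')%O -> (f s < f s')%O.
Proof.
by move=> ss'; rewrite lt_neqAle (inj_eq amalgam_inj) (lt_eqF ss') amalgam_le // ltW.
Qed.

Lemma amalgam_leP p p' : (p <= p')%O ->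
  (exists s s', [/\ p = f s, p' = f s' & (s <= s')%O]) \/
  (exists q q', [/\ p = g q, p' = g q' & (q <= q')%O]).
Proof.
case: am => _ _ ord _ _ /ord[] [x [x' [<- <- xx']]]; [left|right]; by exists x, x'.
Qed.

Lemma amalgam_ltP p p' : (p < p')%O ->
  (exists s s', [/\ p = f s, p' = f s' & (s < s')%O]) \/
  (exists q q', [/\ p = g q, p' = g q' & (q < q')%O]).
Proof.
move=> pp'; case: (amalgam_leP (ltW pp')) => -[x [x' [pE pE' xx']]]; [left|right];
  exists x, x'; split=> //; rewrite lt_neqAle xx' andbT;
  by apply: contraTneq pp' => xE; rewrite pE pE' xE ltxx.
Qed.

Lemma amalgam_match s q : f s = g q ->
  minimal s /\ minimal q \/ maximal s /\ maximal q.
Proof. by case: am => _ _ _ mat _ /mat /orP[]/andP[]; [left|right]. Qed.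

Lemma glued_Ext s q : f s = g q -> s \in Ext S.
Proof. by move=> /amalgam_match[[]|[]]; rewrite mem_Ext => ->; rewrite ?orbT. Qed.

(** The locality behind the whole gluing argument. If the relation above [f s'] came from [Q], then
    [s'] would be glued, hence maximal on both sides since [s] lies below it; but then nothing of
    [Q] lies above it. *)
Lemma amalgam_above s s' p : (s < s')%O -> (f s' < p)%O ->
  exists2 v, p = f v & (s' < v)%O.
Proof.
move=> ss' /amalgam_ltP[] [x [x' [sE -> xx']]].
  by exists x' => //; rewrite (amalgam_inj sE).
case: (amalgam_match sE) => -[].
  by move=> /minimalP/(_ _ (ltW ss')) sE'; rewrite sE' ltxx in ss'.
by move=> _ /maximalP/(_ _ (ltW xx')) xE; rewrite xE ltxx in xx'.
Qed.

Lemma amalgam_below s s' p : (s < s')%O -> (p < f s)%O ->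
  exists2 v, p = f v & (v < s)%O.
Proof.
move=> ss' /amalgam_ltP[] [x [x' [-> sE xx']]].
  by exists x => //; rewrite (amalgam_inj sE).
case: (amalgam_match sE) => -[]; last first.
  by move=> /maximalP/(_ _ (ltW ss')) sE'; rewrite sE' ltxx in ss'.
by move=> _ /minimalP/(_ _ (ltW xx')) xE; rewrite xE ltxx in xx'.
Qed.

(** A glued minimal element of [S] is matched as a minimal one, since [noisoS] forbids it to be
    maximal too; so [Q] adds nothing below it. *)
Lemma amalgam_minimal s : minimal (f s) = minimal s.
Proof.
apply/minimalP/minimalP => sm.
  by move=> s' /amalgam_le/sm/amalgam_inj.
move=> p /amalgam_leP[] [x [x' [-> sE xx']]].
  by move: xx'; rewrite -(amalgam_inj sE) => /sm->.
case: (amalgam_match sE) => -[].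
  by move=> _ /minimalP/(_ _ xx') ->; rewrite sE.
by move=> smax; have := noisoS s; rewrite smax andbT => /negP[]; apply/minimalP.
Qed.

Lemma amalgam_maximal s : maximal (f s) = maximal s.
Proof.
apply/maximalP/maximalP => sm.
  by move=> s' /amalgam_le/sm/amalgam_inj.
move=> p /amalgam_leP[] [x [x' [sE -> xx']]].
  by move: xx'; rewrite -(amalgam_inj sE) => /sm->.
case: (amalgam_match sE) => -[]; last first.
  by move=> _ /maximalP/(_ _ xx') ->; rewrite sE.
by move=> smin; have := noisoS s; rewrite smin => /negP[]; apply/maximalP.
Qed.

Lemma amalgam_Ext s : (f s \in Ext P) = (s \in Ext S).
Proof. by rewrite !mem_Ext amalgam_minimal amalgam_maximal. Qed.

Lemma amalgam_ext_rel s s' :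
  (s, s') \in ext_rel S -> (f s, f s') \in ext_rel P.
Proof. by rewrite !mem_ext_rel !amalgam_Ext => /and3P[/amalgam_lt-> -> ->]. Qed.

Lemma amalgam_noiso s : ~~ (minimal (f s) && maximal (f s)).
Proof. by rewrite amalgam_minimal amalgam_maximal. Qed.

(** A non-extremal [s] is not glued, so everything comparable with [f s] comes from [S]. *)
Lemma amalgam_sole_minimal s m : s \notin Ext S -> sole_minimal s m ->
  sole_minimal (f s) (f m).
Proof.
move=> sE [mmin ms muniq]; split; rewrite ?amalgam_minimal ?amalgam_le //.
move=> p + /amalgam_leP[] [x [x' [pE sE' xx']]].
  by rewrite pE amalgam_minimal => /muniq -> //; rewrite (amalgam_inj sE').
by rewrite (glued_Ext sE') in sE.
Qed.

Lemma amalgam_sole_maximal s m : s \notin Ext S -> sole_maximal s m ->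
  sole_maximal (f s) (f m).
Proof.
move=> sE [mmin ms muniq]; split; rewrite ?amalgam_maximal ?amalgam_le //.
move=> p + /amalgam_leP[] [x [x' [sE' pE xx']]].
  by rewrite pE amalgam_maximal => /muniq -> //; rewrite (amalgam_inj sE').
by rewrite (glued_Ext sE') in sE.
Qed.

Lemma amalgam_conical s : locally_conical S -> f s \notin Ext P ->
  (exists m, sole_minimal (f s) m) \/ (exists m, sole_maximal (f s) m).
Proof.
rewrite amalgam_Ext => con sE; case: (con _ sE) => -[m sm]; [left|right]; exists (f m).
  exact: amalgam_sole_minimal.
exact: amalgam_sole_maximal.
Qed.

Lemma amalgam_connected (B : {set P}) : ext_connected S -> B \subset Ext P ->
    (forall e, e \in ext_rel P -> (e.1 \in B) = (e.2 \in B)) ->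
    (exists s, f s \in B) ->
  forall s, s \in Ext S -> f s \in B.
Proof.
move=> con BE clB [s0 s0B] s sE.
suff BE' : [set s' | f s' \in B] = Ext S by move: sE; rewrite -BE' inE.
apply: con.
- by apply/fintype.subsetP => s'; rewrite inE => /(fintype.subsetP BE); rewrite amalgam_Ext.
- by apply/set0Pn; exists s0; rewrite inE.
- by move=> [x y] /amalgam_ext_rel /clB; rewrite !inE.
Qed.

Section Pairs.
Variables (X : {set S * S}) (Y : {set Q * Q}).
Hypothesis XRel : X \subset Rel S.

Let Xlt s s' : (s, s') \in X -> (s < s')%O.
Proof. by move/(fintype.subsetP XRel); rewrite inE. Qed.

Lemma glue_pairsP p p' : (p, p') \in glue_pairs f g X Y <->
  (exists s s', [/\ p = f s, p' = f s' & (s, s') \in X]) \/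
  (exists q q', [/\ p = g q, p' = g q' & (q, q') \in Y]).
Proof.
rewrite inE; split=> [/orP[] /imsetP[[x x'] xX [-> ->]]|].
- by left; exists x, x'.
- by right; exists x, x'.
- case=> -[x [x' [-> -> xX]]]; apply/orP; [left|right]; apply/imsetP; by exists (x, x').
Qed.

(** A pair of [S] that also arises from [Q] has both ends glued, hence extremal, and so belongs to
    [X] already. *)
Lemma mem_glue_pairs s s' : ext_rel S \subset X -> (s < s')%O ->
  ((f s, f s') \in glue_pairs f g X Y) = ((s, s') \in X).
Proof.
move=> EX ss'; apply/idP/idP => [/glue_pairsP[] [x [x' [sE sE' xX]]]|sX].
- by rewrite (amalgam_inj sE) (amalgam_inj sE').
- apply: (fintype.subsetP EX); rewrite mem_ext_rel ss' /=.
  by rewrite (glued_Ext sE) (glued_Ext sE').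
- by apply/glue_pairsP; left; exists s, s'.
Qed.

(** Only relations between extremal elements can be shared by the two sides. *)
Lemma card_glue_pairs : [disjoint X & ext_rel S] ->
  #|glue_pairs f g X Y| = (#|X| + #|Y|)%N.
Proof.
move=> XE.
have finj := amalgam_inj; have ginj : injective g by case: am => -[].
rewrite cardsU (_ : _ :&: _ = finset.set0) ?cards0 ?subn0.
  rewrite !card_imset //; first by move=> [x y] [x' y'] [/ginj-> /ginj->].
  by move=> [x y] [x' y'] [/finj-> /finj->].
apply/setP => -[p p']; rewrite [RHS]inE; apply/negP => /setIP[].
move=> /imsetP[[s s'] ssX [-> ->]] /imsetP[[q q'] _ [sE sE']].
have := disjointFr XE ssX; rewrite mem_ext_rel (Xlt ssX).
by rewrite (glued_Ext sE) (glued_Ext sE').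
Qed.

End Pairs.

End Amalgam.

Section GluePairs.
Context {dS dQ dP : Order.disp_t} (S : finPOrderType dS)
  (Q : finPOrderType dQ) (P : finPOrderType dP) (f : S -> P) (g : Q -> P).
Hypothesis am : amalgam f g.
Implicit Types (s : S) (q : Q) (p : P).

Lemma glue_pairs_eq (X : {set S * S}) (Y : {set Q * Q}) (Z : {set P * P}) :
    X \subset Rel S -> Y \subset Rel Q -> Z \subset Rel P ->
    (forall s s', (s < s')%O -> ((f s, f s') \in Z) = ((s, s') \in X)) ->
    (forall q q', (q < q')%O -> ((g q, g q') \in Z) = ((q, q') \in Y)) ->
  Z = glue_pairs f g X Y.
Proof.
move=> /fintype.subsetP XR /fintype.subsetP YR /fintype.subsetP ZR ZX ZY.
apply/setP => -[p p']; apply/idP/idP => [pZ|/glue_pairsP[] [x [x' [-> -> xx']]]].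
- have : (p < p')%O by have := ZR _ pZ; rewrite inE.
  move=> /(amalgam_ltP am)[] [x [x' [pE pE' xx']]]; apply/glue_pairsP; [left|right];
    by exists x, x'; split=> //; rewrite -?(ZX, ZY) // -pE -pE'.
- by rewrite ZX //; have := XR _ xx'; rewrite inE.
- by rewrite ZY //; have := YR _ xx'; rewrite inE.
Qed.

Lemma glue_pairs_Rel (X : {set S * S}) (Y : {set Q * Q}) :
  X \subset Rel S -> Y \subset Rel Q -> glue_pairs f g X Y \subset Rel P.
Proof.
move=> /fintype.subsetP XR /fintype.subsetP YR; apply/fintype.subsetP => -[p p'].
have am' := amalgam_sym am.
case/glue_pairsP=> -[x [x' [-> -> /=]]].
  by move/XR; rewrite !inE; exact: (amalgam_lt am).
by move/YR; rewrite !inE; exact: (amalgam_lt am').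
Qed.

End GluePairs.

Lemma sum_image (k : fieldType) (S P : finType) (f : S -> P) (A : pred S) (B : pred P)
    (c : P -> k) : injective f -> (forall v, A v -> B (f v)) ->
    (forall w, B w -> c w != 0 -> exists2 v, w = f v & A v) ->
  \sum_(w | B w) c w = \sum_(v | A v) c (f v).
Proof.
move=> finj AB BA; rewrite -(big_imset (h := f) (A := A) c) /=; last by move=> x y _ _ /finj.
rewrite (bigID [in f @: A]) /= [X in _ + X]big1 ?addr0; last first.
  move=> w /andP[Bw wA]; apply/eqP/negPn/negP => /(BA _ Bw)[v wv Av].
  by move/negP: wA; apply; rewrite wv; apply: imset_f.
apply: eq_bigl => w; apply: andb_idl => /imsetP[v Av ->]; exact: AB.
Qed.

(** * Restriction of the invariant to one side of a gluing *)

Section GlueSide.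
Context (k : fieldType) {dS dQ dP : Order.disp_t} (S : finPOrderType dS)
  (Q : finPOrderType dQ) (P : finPOrderType dP) (f : S -> P) (g : Q -> P).
Variables (NS TS : {set S * S}) (NQ TQ : {set Q * Q}).
Hypothesis am : amalgam f g.
Hypothesis dataS : toral_data k NS TS.
Hypothesis dataQ : toral_data k NQ TQ.
Implicit Types (s : S) (q : Q) (p : P).

Local Notation N := (glue_pairs f g NS NQ).
Local Notation T := (glue_pairs f g TS TQ).

Let am' := amalgam_sym am.
Let finj := amalgam_inj am.

Lemma data_extN (d : Order.disp_t) (A : finPOrderType d) (NA TA : {set A * A}) :
  toral_data k NA TA -> ext_rel A \subset NA.
Proof. by move=> dataA; exact: fintype.subset_trans (data_ext dataA) (data_sub dataA). Qed.

Lemma data_TRel (d : Order.disp_t) (A : finPOrderType d) (NA TA : {set A * A}) :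
  toral_data k NA TA -> TA \subset Rel A.
Proof. by move=> dataA; exact: fintype.subset_trans (data_sub dataA) (data_Rel dataA). Qed.

Let N_lt p p' : (p, p') \in N -> (p < p')%O.
Proof.
by move/(fintype.subsetP (glue_pairs_Rel am (data_Rel dataS) (data_Rel dataQ))); rewrite inE.
Qed.

Lemma glue_memN s s' : (s < s')%O -> ((f s, f s') \in N) = ((s, s') \in NS).
Proof. exact: mem_glue_pairs (data_extN dataS). Qed.

Lemma glue_memT s s' : (s < s')%O -> ((f s, f s') \in T) = ((s, s') \in TS).
Proof. exact: mem_glue_pairs (data_ext dataS). Qed.

Lemma glue_mem_ext s s' : (s < s')%O ->
  ((f s, f s') \in ext_rel P) = ((s, s') \in ext_rel S).
Proof.
have E := amalgam_Ext am (data_noiso dataS).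
by move=> ss'; rewrite !mem_ext_rel !E ss' (amalgam_lt am ss').
Qed.

Let NS_lt s s' : (s, s') \in NS -> (s < s')%O.
Proof. by move/(fintype.subsetP (data_Rel dataS)); rewrite inE. Qed.

Lemma glue_abelian_side s s' p : (s, s') \in NS -> (f s', p) \notin N.
Proof.
move=> ssN; apply/negP => s'pN; have ss' := NS_lt ssN.
have [v pE s'v] := amalgam_above am ss' (N_lt s'pN).
by move: s'pN; rewrite pE glue_memN // (negbTE (data_abelian dataS v ssN)).
Qed.

Lemma glue_split_side s s' p : (s < s')%O -> (f s' < p)%O -> (f s, p) \in N ->
  (f s, f s') \in N \/ (f s', p) \in N.
Proof.
move=> ss' /(amalgam_above am ss')[v -> s'v].
rewrite !glue_memN //; last exact: lt_trans s'v.
exact: (data_split dataS).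
Qed.

(** The restriction of [b] to [S] satisfies the hypotheses of [rigid] there. An entry coming from a
    relation of [Q] would sit at an extremal pair, hence in [N], where [b] vanishes; and by
    [amalgam_above] and [amalgam_below] the nonzero terms of both sums are indexed by elements of
    [S]. *)
Lemma glue_rigid_side (b : P -> P -> k) :
    (forall p p', b p p' != 0 -> p = p' \/ (p < p')%O /\ (p, p') \notin N) ->
    (forall p p', (p, p') \in N ->
      \sum_(v | (p, v) \in T) b p' v = \sum_(u | (u, p') \in T) b u p) ->
  exists a, forall s s', b (f s) (f s') = a *+ (s == s').
Proof.
move=> bN bT; apply: (data_rigid dataS) (fun s s' => b (f s) (f s')) _ _.
  move=> s s' /bN[/finj|[ss' ssN]]; [by left|right].
  case: (amalgam_ltP am ss') => -[x [x' [sE sE' xx']]].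
    move: xx'; rewrite -(finj sE) -(finj sE') => {}ss'; split=> //.
    by rewrite -glue_memN.
  move/negP: ssN; case; apply/glue_pairsP; right; exists x, x'; split=> //.
  apply: (fintype.subsetP (data_extN dataQ)); rewrite mem_ext_rel xx' /=.
  by rewrite (glued_Ext am' (esym sE)) (glued_Ext am' (esym sE')).
move=> s s' ssN; have ss' := NS_lt ssN.
have TS_lt u v : (u, v) \in TS -> (u < v)%O.
  by move/(fintype.subsetP (data_TRel dataS)); rewrite inE.
have T_f u v : (u, v) \in TS -> (f u, f v) \in T.
  by move=> uv; apply/glue_pairsP; left; exists u, v.
have := bT (f s) (f s'); rewrite glue_memN // => /(_ ssN).
rewrite (sum_image (f := f) (A := fun v => (s, v) \in TS)) //; last 2 first.
- by move=> v /T_f.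
- move=> w swT /bN[wE|[s'w _]].
    by exists s' => //; rewrite -glue_memT // wE.
  have [v wE s'v] := amalgam_above am ss' s'w; exists v => //.
  by rewrite -glue_memT ?wE -?wE // (lt_trans ss').
rewrite (sum_image (f := f) (A := fun u => (u, s') \in TS)) //.
- by move=> v /T_f.
- move=> w swT /bN[wE|[ws _]].
    by exists s => //; rewrite -glue_memT // -wE.
  have [v wE vs] := amalgam_below am ss' ws; exists v => //.
  by rewrite -glue_memT -?wE // (lt_trans vs).
Qed.

End GlueSide.

Theorem glue_toral_data (k : fieldType) (dS dQ dP : Order.disp_t)
    (S : finPOrderType dS) (Q : finPOrderType dQ) (P : finPOrderType dP)
    (f : S -> P) (g : Q -> P) (NS TS : {set S * S}) (NQ TQ : {set Q * Q}) :
    amalgam f g -> toral_data k NS TS -> toral_data k NQ TQ ->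
  toral_data k (glue_pairs f g NS NQ) (glue_pairs f g TS TQ).
Proof.
move=> am DS DQ; have am' := amalgam_sym am.
have cover := amalgam_cover am.
have ES := amalgam_Ext am (data_noiso DS).
have EQ := amalgam_Ext am' (data_noiso DQ).
have NRel := glue_pairs_Rel am (data_Rel DS) (data_Rel DQ).
have memNS := glue_memN NQ am DS; have memTS := glue_memT TQ am DS.
have memNQ q q' : (q < q')%O -> ((g q, g q') \in glue_pairs f g NS NQ) = ((q, q') \in NQ).
  by rewrite glue_pairsC; exact: (glue_memN NS am' DQ).
have memTQ q q' : (q < q')%O -> ((g q, g q') \in glue_pairs f g TS TQ) = ((q, q') \in TQ).
  by rewrite glue_pairsC; exact: (glue_memT TS am' DQ).
have memES := glue_mem_ext am DS; have memEQ := glue_mem_ext am' DQ.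
have [s0 [q0 s0q0]] : exists s q, f s = g q by case: am.
split=> //.
- move=> p q r /glue_pairsP[] [x [x' [_ -> xx']]].
    exact: (glue_abelian_side am DS DQ _ xx').
  by rewrite glue_pairsC; exact: (glue_abelian_side am' DQ DS _ xx').
- move=> p q r /(amalgam_ltP am)[] [x [x' [-> -> xx']]].
    by move=> *; exact: (glue_split_side am DS).
  by rewrite glue_pairsC => *; exact: (glue_split_side am' DQ).
- apply/fintype.subsetP => -[p p'] /glue_pairsP[] [x [x' [-> -> xx']]]; apply/glue_pairsP.
    by left; exists x, x'; split=> //; exact: (fintype.subsetP (data_sub DS)).
  by right; exists x, x'; split=> //; exact: (fintype.subsetP (data_sub DQ)).
- move=> b bN bT.
  have [a aE] := glue_rigid_side am DS DQ bN bT.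
  have [a' aE'] : exists a, forall q q', b (g q) (g q') = a *+ (q == q').
    by move: bN bT; rewrite ![glue_pairs f g _ _]glue_pairsC; exact: glue_rigid_side.
  (* The two scalars are compared at an identified element. *)
  have aa' : a' = a by have := aE s0 s0; rewrite s0q0 aE' !eqxx.
  exists a => p p'; have [<-|pp'] := eqVneq p p'.
    by case: (cover p) => -[x ->]; rewrite ?aE ?aE' eqxx ?aa'.
  apply/eqP/negPn/negP => bpp; case: (bN _ _ bpp) => [|[]]; first exact/eqP.
  move=> /(amalgam_ltP am)[] [x [x' [pE pE' xx']]] _.
    by move: bpp; rewrite pE pE' aE (lt_eqF xx') eqxx.
  by move: bpp; rewrite pE pE' aE' (lt_eqF xx') eqxx.
- apply/fintype.subsetP => -[p p'] pp'E.
  have : (p < p')%O by move: pp'E; rewrite mem_ext_rel => /andP[].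
  move=> /(amalgam_ltP am)[] [x [x' [pE pE' xx']]]; move: pp'E; rewrite pE pE'.
    by rewrite memES // memTS //; exact: (fintype.subsetP (data_ext DS)).
  by rewrite memEQ // memTQ //; exact: (fintype.subsetP (data_ext DQ)).
(* Pairs of [N] outside [ext_rel], relations outside [N], and non-extremal elements are never
   shared, so all three cardinals in [data_card] are sums over the two sides. *)
- have -> : glue_pairs f g NS NQ :\: ext_rel P =
      glue_pairs f g (NS :\: ext_rel S) (NQ :\: ext_rel Q).
    apply: (glue_pairs_eq am).
    + exact: fintype.subset_trans (finset.subsetDl _ _) (data_Rel DS).
    + exact: fintype.subset_trans (finset.subsetDl _ _) (data_Rel DQ).
    + exact: fintype.subset_trans (finset.subsetDl _ _) NRel.
    + by move=> s s' ss'; rewrite !finset.in_setD memES ?memNS.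
    + by move=> q q' qq'; rewrite !finset.in_setD memEQ ?memNQ.
  have -> : Rel P :\: glue_pairs f g NS NQ = glue_pairs f g (Rel S :\: NS) (Rel Q :\: NQ).
    apply: (glue_pairs_eq am); try exact: finset.subsetDl.
    + move=> s s' ss'; rewrite !finset.in_setD memNS // !mem_Rel.
      by rewrite ss' (amalgam_lt am ss').
    + move=> q q' qq'; rewrite !finset.in_setD memNQ // !mem_Rel.
      by rewrite qq' (amalgam_lt am' qq').
  rewrite (card_glue_pairs am); first last.
  + rewrite disjoint_sym finset.disjoints_subset; apply/fintype.subsetP => e eE.
    by rewrite finset.in_setC finset.in_setD eE.
  + exact: fintype.subset_trans (finset.subsetDl _ _) (data_Rel DS).
  rewrite (card_glue_pairs am); first last.
  + rewrite disjoint_sym finset.disjoints_subset; apply/fintype.subsetP => e eE.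
    by rewrite finset.in_setC finset.in_setD (fintype.subsetP (data_extN DS) _ eE).
  + exact: finset.subsetDl.
  have -> : #|~: Ext P| = (#|~: Ext S| + #|~: Ext Q|)%N.
    have -> : ~: Ext P = f @: (~: Ext S) :|: g @: (~: Ext Q).
      apply/setP => p; rewrite finset.in_setC finset.in_setU; apply/idP/orP.
        by case: (cover p) => -[x ->]; rewrite ?ES ?EQ => xE; [left|right];
          apply: imset_f; rewrite finset.in_setC.
      by move=> [] /imsetP[x + ->]; rewrite finset.in_setC ?ES ?EQ.
    rewrite cardsU (_ : _ :&: _ = finset.set0) ?cards0 ?subn0.
      by rewrite !card_imset //; [exact: amalgam_inj am'|exact: amalgam_inj am].
    apply/setP => p; rewrite [RHS]inE; apply/negP => /setIP[].
    move=> /imsetP[s sE ->] /imsetP[q _ /(glued_Ext am) sE'].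
    by move: sE; rewrite finset.in_setC sE'.
  rewrite (data_card DS) (data_card DQ); lia.
- move=> p; case: (cover p) => -[x ->].
    exact: (amalgam_conical am (data_noiso DS) (data_conical DS)).
  exact: (amalgam_conical am' (data_noiso DQ) (data_conical DQ)).
- move=> B BE /set0Pn[p pB] clB.
  have sideS := amalgam_connected am (data_noiso DS) (data_connected DS) BE clB.
  have sideQ := amalgam_connected am' (data_noiso DQ) (data_connected DQ) BE clB.
  have s0E := glued_Ext am s0q0; have q0E := glued_Ext am' (esym s0q0).
  (* [B] meets one of the sides and so contains its extremal elements, among them the identified
     element, through which it reaches the other side. *)
  have Bs0 : f s0 \in B.
    by case: (cover p) => -[x pE]; [|rewrite s0q0]; (apply: sideS || apply: sideQ) => //;
       exists x; rewrite -pE.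
  apply/eqP; rewrite finset.eqEsubset BE; apply/fintype.subsetP => r.
  case: (cover r) => -[x ->]; rewrite ?ES ?EQ => xE.
    by apply: sideS => //; exists s0.
  by apply: sideQ => //; exists q0; rewrite -s0q0.
- move=> p; case: (cover p) => -[x ->].
    exact: (amalgam_noiso am (data_noiso DS)).
  exact: (amalgam_noiso am' (data_noiso DQ)).
- by apply/set0Pn; exists (f s0); rewrite ES; exact: (glued_Ext am s0q0).
Qed.

(** * Toral-pairs and toral posets *)

Lemma connect_step (V : finType) (e : rel V) (x y : V) :
  connect e x y -> x != y -> exists z, e x z.
Proof.
move=> /connectP[[|z p] /= +] -> ; first by rewrite eqxx.
by move=> /andP[xz _] _; exists z.
Qed.

(** * A toral-pair satisfies the invariant *)

Section Base.
Context (k : fieldType) (R : realType) {d : Order.disp_t} (P : finPOrderType d).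
Variable T : {set P * P}.
Hypothesis toral : toral_pair k R T.
Implicit Types p q r : P.

Definition source_sink_pairs : {set P * P} :=
  [set pq in Rel P | (pq.1 \in sources T) && (pq.2 \in sinks T)].

Local Notation N := source_sink_pairs.

Lemma mem_source_sink p q :
  ((p, q) \in N) = [&& (p < q)%O, p \in sources T & q \in sinks T].
Proof. by rewrite /source_sink_pairs finset.in_set mem_Rel. Qed.

Let T_lt p q : (p, q) \in T -> (p < q)%O.
Proof. by have [/fintype.subsetP TR _] := toral_F1 toral; move=> /TR; rewrite mem_Rel. Qed.

Let adj p q := ((p, q) \in T) || ((q, p) \in T).

Let adj_step p : exists q, adj p q.
Proof.
have [_ [con _]] := toral_F1 toral.
have [q pq] : exists q, p != q.
  have : (1 < #|Ext P|)%N by case: (toral_P1 toral) => ->.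
  case/card_gt1P=> x [y [_ _ xy]]; have [->|px] := eqVneq p x; first by exists y.
  by exists x.
exact: connect_step (con p q) pq.
Qed.

Lemma mem_sinks p : reflect (forall q, (p, q) \notin T) (p \in sinks T).
Proof. by rewrite /sinks finset.in_set; exact: forallP. Qed.

Lemma mem_sources p : reflect (forall q, (q, p) \notin T) (p \in sources T).
Proof. by rewrite /sources finset.in_set; exact: forallP. Qed.

Lemma sink_or_source p : (p \in sinks T) || (p \in sources T).
Proof.
have [_ _ /setP/(_ p)] := toral_F2 toral.
by rewrite /inner_vertices finset.in_setC finset.in_setU finset.in_set0 => /negbFE.
Qed.

(** A vertex that is both would be isolated, but the graph is connected and has at least two
    vertices. *)
Lemma sink_not_source p : p \in sinks T -> p \notin sources T.
Proof.
move=> /mem_sinks psink; apply/mem_sources => psource.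
have [q /orP[]] := adj_step p.
  by rewrite (negbTE (psink q)).
by rewrite (negbTE (psource q)).
Qed.

Lemma source_sink_sub : T \subset N.
Proof.
apply/fintype.subsetP => -[p q] pqT; rewrite mem_source_sink T_lt //=.
apply/andP; split.
  have := sink_or_source p; case: mem_sinks => // /(_ q).
  by rewrite pqT.
have := sink_or_source q; rewrite orbC; case: mem_sources => // /(_ p).
by rewrite pqT.
Qed.

Lemma source_sink_Rel : N \subset Rel P.
Proof. by apply/fintype.subsetP => -[p q]; rewrite mem_source_sink mem_Rel => /andP[]. Qed.

Lemma source_sink_abelian p q r : (p, q) \in N -> (q, r) \notin N.
Proof.
rewrite !mem_source_sink => /and3P[_ _ /sink_not_source/negbTE ->].
by rewrite andbF.
Qed.

Lemma source_sink_split p q r : (p < q)%O -> (q < r)%O -> (p, r) \in N ->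
  (p, q) \in N \/ (q, r) \in N.
Proof.
rewrite !mem_source_sink => -> -> /and3P[_ -> ->].
by case/orP: (sink_or_source q) => ->; [left|right].
Qed.

(** (F4) requires orthogonality to all of [lie_poset], whereas only the units in [N] are given; for
    matrices supported off [N] the remaining equations hold trivially. *)
Lemma source_sink_rigid : rigid k N T.
Proof.
move=> b bN bT.
have TN p q : (p, q) \in T -> (p, q) \in N := fintype.subsetP source_sink_sub _.
have b0 p q : (p, q) \in N -> b p q = 0.
  move=> pqN; apply/eqP/negPn/negP => /bN[pq|[_]]; last by rewrite pqN.
  by move: pqN; rewrite mem_source_sink pq ltxx.
(* Off [N] every term is zero: a nonzero one would split a pair of [T] through [q] or [p] into
   relations outside [N], against [source_sink_split]. *)
have eqs p q : (p <= q)%O ->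
    \sum_(v | (p, v) \in T) b q v = \sum_(u | (u, q) \in T) b u p.
  have [pqN _|pqN pq] := boolP ((p, q) \in N); first exact: bT.
  rewrite big1 ?big1 // => u /TN uN; apply/eqP/negPn/negP => /bN[uE|[uq uqN]].
  - by rewrite -uE uN in pqN.
  - move: pq; rewrite le_eqVlt => /orP[/eqP pq|pq].
      by rewrite pq uN in uqN.
    case: (source_sink_split uq pq uN) => H; first by rewrite H in uqN.
    by rewrite H in pqN.
  - by rewrite uE uN in pqN.
  - move: pq; rewrite le_eqVlt => /orP[/eqP pq|pq].
      by rewrite -pq uN in uqN.
    case: (source_sink_split pq uq uN) => H; first by rewrite H in pqN.
    by rewrite H in uqN.
have matP : mat b \in lie_poset k P.
  apply/mem_lie_poset => p q pq; rewrite coeff_mat; apply/eqP/negPn/negP.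
  by move=> /bN[pE|[/ltW pq' _]]; [rewrite pE lexx in pq|rewrite pq' in pq].
have [|diag off] := toral_F4 toral matP.
  move=> x xP.
  rewrite [x]sum_units.
  rewrite /lie_bracket mulmx_suml mulmx_sumr -sumrB linear_sum big1 // => -[p q] _ /=.
  rewrite -scalemxAl -scalemxAr -scalerBr linearZ /=.
  have [pq|pq] := boolP (p <= q)%O; last first.
    by move/mem_lie_poset: xP => ->; rewrite ?scale0r.
  rewrite -[_ *m _ - _]/(lie_bracket _ _) functional_bracket_E.
  under eq_bigr do rewrite coeff_mat.
  under [X in _ - X]eq_bigr do rewrite coeff_mat.
  by rewrite eqs // subrr scaler0.
have [p0|noP] := pselect (inhabited P); last first.
  by exists 0 => p; case: noP.
case: p0 => p0; exists (b p0 p0) => p q; have [<-|pq] := eqVneq p q.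
  by have := diag p p0; rewrite !coeff_mat mulr1n.
rewrite mulr0n; apply/eqP/negPn/negP => bpq; case: (bN _ _ bpq) => [/eqP|[pq' _]].
  by rewrite (negbTE pq).
by have := off _ _ pq'; rewrite coeff_mat; apply/eqP.
Qed.

Lemma toral_pair_noiso p : ~~ (minimal p && maximal p).
Proof.
apply/negP => /andP[/minimalP pmin /maximalP pmax].
have [q adjpq] := adj_step p; case/orP: adjpq => /T_lt pq.
  by move: (pq); rewrite (pmax _ (ltW pq)) ltxx.
by move: (pq); rewrite (pmin _ (ltW pq)) ltxx.
Qed.

Definition Min : {set P} := [set p | minimal p].
Definition Max : {set P} := [set p | maximal p].

Lemma mem_Min p : (p \in Min) = minimal p. Proof. by rewrite finset.in_set. Qed.
Lemma mem_Max p : (p \in Max) = maximal p. Proof. by rewrite finset.in_set. Qed.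

Lemma card_Ext_Min_Max : #|Ext P| = (#|Min| + #|Max|)%N.
Proof.
have -> : Ext P = Min :|: Max.
  by apply/setP => p; rewrite mem_Ext finset.in_setU mem_Min mem_Max.
rewrite cardsU (_ : Min :&: Max = finset.set0) ?cards0 ?subn0 //.
apply/setP => p; rewrite finset.in_setI mem_Min mem_Max finset.in_set0.
exact/negbTE/toral_pair_noiso.
Qed.

(** By (P1), two positive numbers have a sum of at most 3. *)
Lemma Min_or_Max_singleton : #|Min| = 1%N \/ #|Max| = 1%N.
Proof.
have /card_gt0P[p _] : (0 < #|Ext P|)%N by case: (toral_P1 toral) => ->.
have [m mmin _] := minimal_below p; have [M Mmax _] := maximal_above p.
have : (0 < #|Min|)%N by apply/card_gt0P; exists m; rewrite mem_Min.
have : (0 < #|Max|)%N by apply/card_gt0P; exists M; rewrite mem_Max.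
have := toral_P1 toral; rewrite card_Ext_Min_Max.
by move: #|Min| #|Max| => a b; lia.
Qed.

Lemma sole_minimal_all m : Min = [set m] -> forall p, sole_minimal p m.
Proof.
move=> MinE; have uniq m' : minimal m' -> m' = m.
  by rewrite -mem_Min MinE => /set1P.
move=> p; have [m' m'min m'p] := minimal_below p.
by rewrite -(uniq _ m'min); split=> // m'' /uniq ->; rewrite -(uniq _ m'min).
Qed.

Lemma sole_maximal_all m : Max = [set m] -> forall p, sole_maximal p m.
Proof.
move=> MaxE; have uniq m' : maximal m' -> m' = m.
  by rewrite -mem_Max MaxE => /set1P.
move=> p; have [m' m'max m'p] := maximal_above p.
by rewrite -(uniq _ m'max); split=> // m'' /uniq ->; rewrite -(uniq _ m'max).
Qed.

Lemma toral_pair_conical : locally_conical P.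
Proof.
move=> p _; case: Min_or_Max_singleton => /eqP/cards1P[m mE]; [left|right]; exists m.
  exact: sole_minimal_all.
exact: sole_maximal_all.
Qed.

(** A sole minimal element is least, and a sole maximal one greatest, so every minimal element lies
    below every maximal one. The extremal graph is therefore a star. *)
Lemma ext_relE : ext_rel P = finset.setX Min Max.
Proof.
apply/setP => -[p q]; rewrite finset.in_setX mem_Min mem_Max; apply/idP/andP.
  exact: ext_rel_min_max.
move=> [pmin qmax]; rewrite mem_ext_rel !mem_Ext pmin qmax orbT andbT /= lt_neqAle.
have le_pq : (p <= q)%O.
  case: Min_or_Max_singleton => /eqP/cards1P[m mE].
    have -> : p = m by apply/set1P; rewrite -mE mem_Min.
    by have [] := sole_minimal_all mE q.
  have -> : q = m by apply/set1P; rewrite -mE mem_Max.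
  by have [] := sole_maximal_all mE p.
rewrite le_pq !andbT; apply: contraNneq (toral_pair_noiso p) => pq.
by rewrite pmin /= pq.
Qed.

Lemma card_toral_ext_rel : (#|ext_rel P| + 1 = #|Ext P|)%N.
Proof.
rewrite ext_relE cardsX card_Ext_Min_Max.
by case: Min_or_Max_singleton => ->; lia.
Qed.

Lemma toral_pair_connected : ext_connected P.
Proof.
move=> B /fintype.subsetP BE /set0Pn[p pB] clB.
have clE m M : minimal m -> maximal M -> (m \in B) = (M \in B).
  move=> mmin Mmax; apply: (clB (m, M)).
  by rewrite ext_relE finset.in_setX mem_Min mem_Max mmin.
have [m mmin _] := minimal_below p; have [M Mmax _] := maximal_above p.
have mB : m \in B.
  have := BE _ pB; rewrite mem_Ext => /orP[pmin|pmax].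
    by rewrite (clE _ _ mmin Mmax) -(clE _ _ pmin Mmax).
  by rewrite (clE _ _ mmin pmax).
apply/setP => q; apply/idP/idP => [/BE//|].
rewrite mem_Ext => /orP[qmin|qmax]; last by rewrite -(clE _ _ mmin qmax).
by rewrite (clE _ _ qmin Mmax) -(clE _ _ mmin Mmax).
Qed.

Theorem toral_pair_data : toral_data k N T.
Proof.
have extT : ext_rel P \subset T.
  apply/fintype.subsetP => -[p q]; rewrite mem_ext_rel => /and3P[pq pE qE].
  exact: (toral_F3 toral) pE qE pq.
have /card_gt0P[p0 p0E] : (0 < #|Ext P|)%N by case: (toral_P1 toral) => ->.
have extN := fintype.subset_trans extT source_sink_sub.
split=> //.
- exact: source_sink_Rel.
- exact: source_sink_abelian.
- exact: source_sink_split.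
- exact: source_sink_sub.
- exact: source_sink_rigid.
(* The count of [frobenius_card] combined with that of the star, which has one edge fewer than
   vertices. *)
- have cP : (#|Ext P| + #|~: Ext P| = #|P|)%N by exact: cardsC.
  have cR : (#|Rel P :\: N| = #|Rel P| - #|N|)%N.
    by rewrite cardsD (finset.setIidPr source_sink_Rel).
  have cN : (#|N :\: ext_rel P| = #|N| - #|ext_rel P|)%N.
    by rewrite cardsD (finset.setIidPr extN).
  have cF := frobenius_card p0 source_sink_Rel source_sink_abelian source_sink_split
    source_sink_sub (toral_functional toral).
  have := subset_leq_card source_sink_Rel; have := subset_leq_card extN.
  move: card_toral_ext_rel cP cR cN cF.
  move: #|Rel P :\: N| #|N :\: ext_rel P| #|N| #|ext_rel P| #|Rel P| #|~: Ext P| #|Ext P| #|P|.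
  lia.
- exact: toral_pair_conical.
- exact: toral_pair_connected.
- exact: toral_pair_noiso.
- by apply/set0Pn; exists p0.
Qed.

End Base.

(** * From construction rules to amalgams, and the induction *)

Section Rules.
Context {dS dQ : Order.disp_t} (S : finPOrderType dS) (Q : finPOrderType dQ).

(** Every rule lists one to three matching pairs; its set is a singleton extended by further
    singletons, which [one] and [more] follow. *)
Lemma construction_rule_matching (I : {set S * Q}) : construction_rule I ->
  I != finset.set0 /\ forall s q, (s, q) \in I -> matching s q.
Proof.
have one a x : matching a x -> [set (a, x)] != finset.set0 /\
    forall (s : S) (q : Q), (s, q) \in [set (a, x)] -> matching s q.
  move=> ax; split; first by apply/set0Pn; exists (a, x); rewrite finset.in_set1.
  by move=> s q /set1P[-> ->].
have more (J : {set S * Q}) a x : matching a x ->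
    (J != finset.set0 /\ forall s q, (s, q) \in J -> matching s q) ->
    J :|: [set (a, x)] != finset.set0 /\
    forall s q, (s, q) \in J :|: [set (a, x)] -> matching s q.
  move=> ax [/set0Pn[e eJ] Jm]; split.
    by apply/set0Pn; exists e; rewrite finset.in_setU eJ.
  by move=> s q /setUP[/Jm//|/set1P[-> ->]].
by case=> *; do ?[apply: (one) | apply: (more)].
Qed.

Lemma glued_amalgam (I : {set S * Q}) (dP : Order.disp_t) (P : finPOrderType dP) :
  construction_rule I -> glued I P ->
  exists (f : S -> P) (g : Q -> P), amalgam f g.
Proof.
move=> /construction_rule_matching[/set0Pn[[s q] sqI] mat].
move=> [f [g [finj ginj cov fgI ord]]]; exists f, g; split=> //.
- by move=> s' q' /fgI/mat.
- by exists s, q; apply/fgI.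
Qed.

End Rules.

Lemma toral_poset_data (k : fieldType) (R : realType) (d : Order.disp_t)
    (P : finPOrderType d) : toral_poset k R P -> exists N T, toral_data k (P := P) N T.
Proof.
elim=> [dP {}P F FP|dQ Q dS S F I dP {}P _ [NQ [TQ DQ]] FS rule gl].
  by exists (source_sink_pairs F), F; exact: toral_pair_data FP.
have [f [g am]] := glued_amalgam rule gl.
by have := glue_toral_data am (toral_pair_data FS) DQ; do 2 eexists; eassumption.
Qed.

Theorem theorem7 (k : fieldType) (chark : ([pchar k] =i pred0)%R)
    (R : realType) (d : Order.disp_t) (P : finPOrderType d)
    (torP : toral_poset k R P) :
  homotopy_equivalent R (realization R (order_complex P))
    (wedge_of_circles R (lie_index (lie_posetA k P))).
Proof.
have [N [T D]] := toral_poset_data torP.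
exact: order_complex_wedge (data_inhabited D) (data_conical D) (data_connected D)
  (toral_data_index chark D).
Qed.
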